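(* Let $n\ge 1$, let $\sigma=\{\sigma_1,\dots,\sigma_n\}$, and let $k$ be a $\sigma$-field. Let $A$ be a finitely $\sigma$-generated $k$-$\sigma$-Hopf algebra. Then any $\sigma$-Hopf ideal $I\subseteq A$ is finitely $\sigma$-generated.
   Context: All rings are commutative with unit; $\mathbb{N}=\{0,1,2,\dots\}$. A $\sigma$-ring is a ring $R$ with $n$ pairwise commuting ring endomorphisms $\sigma_1,\dots,\sigma_n\colon R\to R$; a $\sigma$-field is a $\sigma$-ring whose underlying ring is a field. A morphism of $\sigma$-rings is a ring morphism commuting with each $\sigma_j$. $T_\sigma$ is the free commutative monoid of formal monomials $\tau=\sigma_1^{k_1}\cdots\sigma_n^{k_n}$ ($k_1,\dots,k_n\in\mathbb{N}$), acting on every $\sigma$-ring by composition of endomorphisms. A $\sigma$-ideal of $R$ is an ideal $I$ with $\sigma_j(I)\subseteq I$ for all $j$; for $F\subseteq R$, $[F]$ is the smallest $\sigma$-ideal containing $F$, i.e. the ideal generated by $\{\tau(f)\mid \tau\in T_\sigma, f\in F\}$. A $\sigma$-ideal is finitely $\sigma$-generated if it equals $[F]$ for some finite $F$. A $k$-$\sigma$-algebra is a $\sigma$-ring $R$ that is a $k$-algebra via a morphism $k\to R$ of $\sigma$-rings; it is finitely $\sigma$-generated if it is generated as a $k$-algebra by $\{\tau(f)\mid\tau\in T_\sigma,f\in F\}$ for some finite $F\subseteq R$. The tensor product $R\otimes_k S$ of $k$-$\sigma$-algebras is a $k$-$\sigma$-algebra via $\sigma_j(r\otimes s)=\sigma_j(r)\otimes\sigma_j(s)$.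 A $k$-$\sigma$-Hopf algebra is a (commutative) $k$-Hopf algebra $A$ that is also a $k$-$\sigma$-algebra such that the comultiplication $A\to A\otimes_kA$, antipode $A\to A$ and counit $A\to k$ are morphisms of $k$-$\sigma$-algebras. A $\sigma$-Hopf ideal is a $\sigma$-ideal that is also a Hopf ideal. *)

(* Defs.v *)
From HB Require Import structures.
From mathcomp Require Import all_boot all_algebra.
From mathcomp Require Import boolp classical_sets functions cardinality.

Set Implicit Arguments.
Unset Strict Implicit.
Unset Printing Implicit Defensive.

Import GRing.Theory.

Local Open Scope classical_set_scope.
Local Open Scope ring_scope.
Local Open Scope quotient_scope.

(* A formal sum of pure tensors r_1 (x) s_1 + ... + r_m (x) s_m is coded by the
   sequence [:: (r_1, s_1); ...; (r_m, s_m)]; the negative of (r, s) is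
   (- r, s), so no signs or integer multiplicities are needed. *)
Section TensorRel.
Context {k : fieldType} {R S : comAlgType k}.
Implicit Types (r : R) (s : S) (u v w : seq (R * S)).

Inductive tensor_rel : seq (R * S) -> seq (R * S) -> Prop :=
| trel_refl u : tensor_rel u u
| trel_sym u v : tensor_rel u v -> tensor_rel v u
| trel_trans v u w : tensor_rel u v -> tensor_rel v w -> tensor_rel u w
| trel_cat u u' v v' :
    tensor_rel u u' -> tensor_rel v v' -> tensor_rel (u ++ v) (u' ++ v')
| trel_catC u v : tensor_rel (u ++ v) (v ++ u)
| trel_addl r r' s : tensor_rel [:: (r + r', s)] [:: (r, s); (r', s)]
| trel_addr r s s' : tensor_rel [:: (r, s + s')] [:: (r, s); (r, s')]
| trel_scale (c : k) r s : tensor_rel [:: (c *: r, s)] [:: (r, c *: s)]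
| trel_0 s : tensor_rel [:: (0, s)] [::].

Definition tensor_relb : rel (seq (R * S)) := fun u v => `[< tensor_rel u v >].

Lemma tensor_relb_refl : reflexive tensor_relb.
Proof. by move=> u; apply/asboolP; exact: trel_refl. Qed.

Lemma tensor_relb_sym : symmetric tensor_relb.
Proof. by move=> u v; apply/asboolP/asboolP; exact: trel_sym. Qed.

Lemma tensor_relb_trans : transitive tensor_relb.
Proof.
by move=> v u w /asboolP uv /asboolP vw; apply/asboolP; exact: trel_trans vw.
Qed.

Canonical tensor_equiv :=
  EquivRel tensor_relb tensor_relb_refl tensor_relb_sym tensor_relb_trans.

End TensorRel.

Definition tensor (k : fieldType) (R S : comAlgType k) :=
  {eq_quot @tensor_equiv k R S}.

HB.instance Definition _ (k : fieldType) (R S : comAlgType k) :=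
  Choice.on (tensor R S).
HB.instance Definition _ (k : fieldType) (R S : comAlgType k) :=
  EqQuotient.on (tensor R S).

Section TensorZmod.
Context {k : fieldType} {R S : comAlgType k}.
Local Notation T := (tensor R S).
Implicit Types (r : R) (s : S) (u v w : seq (R * S)) (x y z : T).

Lemma tensor_eqP u v : tensor_rel u v <-> \pi_T u = \pi_T v.
Proof.
split=> [uv|/eqmodP/asboolP //]; apply/eqmodP; exact/asboolP.
Qed.

Lemma tensor_reprP u : tensor_rel (repr (\pi_T u)) u.
Proof. by apply/tensor_eqP; rewrite reprK. Qed.

Definition tzero : T := \pi_T [::].
Definition tadd x y : T := \pi_T (repr x ++ repr y).
Definition tneg_seq u : seq (R * S) := [seq (- p.1, p.2) | p <- u].
Definition topp x : T := \pi_T (tneg_seq (repr x)).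

Lemma tadd_pi u v : tadd (\pi_T u) (\pi_T v) = \pi_T (u ++ v).
Proof. by apply/tensor_eqP; apply: trel_cat; exact: tensor_reprP. Qed.

Lemma tensor_pi x : exists u, x = \pi_T u.
Proof. by exists (repr x); rewrite reprK. Qed.

Lemma taddA : associative tadd.
Proof.
move=> x y z; have [[u ->] [v ->] [w ->]] := And3 (tensor_pi x) (tensor_pi y) (tensor_pi z).
by rewrite !tadd_pi catA.
Qed.

Lemma taddC : commutative tadd.
Proof.
move=> x y; have [[u ->] [v ->]] := (tensor_pi x, tensor_pi y).
by rewrite !tadd_pi; apply/tensor_eqP; exact: trel_catC.
Qed.

Lemma tadd0 : left_id tzero tadd.
Proof. by move=> x; have [u ->] := tensor_pi x; rewrite tadd_pi. Qed.

Lemma tneg_seqP u : tensor_rel (tneg_seq u ++ u) [::].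
Proof.
elim: u => [|[r s] u IH]; first exact: trel_refl.
apply: (@trel_trans _ _ _ ([:: (- r, s); (r, s)] ++ (tneg_seq u ++ u))).
  change (tensor_rel ([:: (- r, s)] ++ tneg_seq u ++ [:: (r, s)] ++ u)
                     ([:: (- r, s)] ++ [:: (r, s)] ++ tneg_seq u ++ u)).
  apply: trel_cat; first exact: trel_refl.
  by rewrite !catA; apply: trel_cat; [exact: trel_catC|exact: trel_refl].
rewrite -[X in tensor_rel _ X]cats0; apply: trel_cat => //.
apply: (@trel_trans _ _ _ [:: (- r + r, s)]).
  by apply: trel_sym; exact: trel_addl.
by rewrite addNr; exact: trel_0.
Qed.

Lemma taddN : left_inverse tzero topp tadd.
Proof.
move=> x; have -> : tadd (topp x) x = tadd (topp x) (\pi_T (repr x)) by rewrite reprK.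
by rewrite tadd_pi; apply/tensor_eqP; exact: tneg_seqP.
Qed.

HB.instance Definition _ := GRing.isZmodule.Build T taddA taddC tadd0 taddN.

Definition tens r s : T := \pi_T [:: (r, s)].

Lemma tensDl s : {morph tens^~ s : r r' / r + r'}.
Proof.
by move=> r r'; rewrite /tens [RHS]tadd_pi; apply/tensor_eqP; exact: trel_addl.
Qed.

Lemma tensDr r : {morph tens r : s s' / s + s'}.
Proof.
by move=> s s'; rewrite /tens [RHS]tadd_pi; apply/tensor_eqP; exact: trel_addr.
Qed.

Lemma tens_scale (c : k) r s : tens (c *: r) s = tens r (c *: s).
Proof. by apply/tensor_eqP; exact: trel_scale. Qed.

Lemma tensor_piE u : \pi_T u = \sum_(p <- u) tens p.1 p.2.
Proof.
elim: u => [|[r s] u IH]; first by rewrite big_nil.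
by rewrite big_cons -IH [RHS]tadd_pi.
Qed.

Lemma tensorE x : x = \sum_(p <- repr x) tens p.1 p.2.
Proof. by rewrite -tensor_piE reprK. Qed.

Lemma tensor_ind (P : T -> Prop) :
  P 0 -> (forall r s x, P x -> P (tens r s + x)) -> forall x, P x.
Proof.
move=> P0 PD x; rewrite (tensorE x); elim: (repr x) => [|p u IH].
  by rewrite big_nil.
by rewrite big_cons; exact: PD.
Qed.

Lemma tensor_ext (V : zmodType) (f g : T -> V) :
  {morph f : x y / x + y} -> {morph g : x y / x + y} ->
  (forall r s, f (tens r s) = g (tens r s)) -> f =1 g.
Proof.
move=> fD gD fg; apply: tensor_ind => [|r s x IH].
  have f0 : f 0 = 0 by apply: (@addrI _ (f 0)); rewrite -fD !addr0.
  have g0 : g 0 = 0 by apply: (@addrI _ (g 0)); rewrite -gD !addr0.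
  by rewrite f0 g0.
by rewrite fD gD IH fg.
Qed.

Definition balanced (V : zmodType) (f : R -> S -> V) : Prop :=
  [/\ forall s, {morph f^~ s : r r' / r + r'},
      forall r, {morph f r : s s' / s + s'}
    & forall (c : k) r s, f (c *: r) s = f r (c *: s)].

(* For balanced f this is the additive map sending r (x) s to f r s; in general
   it depends on the chosen representatives. *)
Definition tens_lift (V : zmodType) (f : R -> S -> V) x : V :=
  \sum_(p <- repr x) f p.1 p.2.

Section Lift.
Context {V : zmodType} {f : R -> S -> V}.
Hypothesis fB : balanced f.

Lemma tens_lift_pi u : tens_lift f (\pi_T u) = \sum_(p <- u) f p.1 p.2.
Proof.
have [fDl fDr fZ] := fB.
rewrite /tens_lift; move: (repr _) (tensor_reprP u) => w wu.
elim: wu => {w u} //.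
- by move=> u v w _ -> _ ->.
- by move=> u u' v v' _ Eu _ Ev; rewrite !big_cat /= Eu Ev.
- by move=> u v; rewrite !big_cat /= addrC.
- by move=> r r' s; rewrite !big_cons !big_nil !addr0 /= fDl.
- by move=> r s s'; rewrite !big_cons !big_nil !addr0 /= fDr.
- by move=> c r s; rewrite !big_cons !big_nil !addr0 /= fZ.
- move=> s; rewrite big_cons !big_nil addr0 /=.
  by apply: (@addrI _ (f 0 s)); rewrite -fDl !addr0.
Qed.

Lemma tens_liftE r s : tens_lift f (tens r s) = f r s.
Proof. by rewrite tens_lift_pi big_cons big_nil addr0. Qed.

Lemma tens_liftD : {morph tens_lift f : x y / x + y}.
Proof.
move=> x y; have [[u ->] [v ->]] := (tensor_pi x, tensor_pi y).
by rewrite [_ + _]tadd_pi !tens_lift_pi big_cat.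
Qed.

Lemma tens_lift0 : tens_lift f 0 = 0.
Proof. by apply: (@addrI _ (tens_lift f 0)); rewrite -tens_liftD !addr0. Qed.

End Lift.

End TensorZmod.

Section TensorLmod.
Context {k : fieldType} {R S : comAlgType k}.
Local Notation T := (tensor R S).
Implicit Types (r : R) (s : S) (x y z : T) (c d : k).

Definition tscale c : T -> T := tens_lift (fun r s => tens (c *: r) s).

Lemma tscale_balanced c : balanced (fun (r : R) (s : S) => tens (c *: r) s).
Proof.
split=> [s r r'|r s s'|d r s]; first by rewrite scalerDr tensDl.
  by rewrite tensDr.
by rewrite scalerA mulrC -scalerA tens_scale.
Qed.

Let tscaleE c r s : tscale c (tens r s) = tens (c *: r) s.
Proof. exact: tens_liftE (tscale_balanced c) r s. Qed.

Let tscaleDr c : {morph tscale c : x y / x + y}.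
Proof. exact: tens_liftD (tscale_balanced c). Qed.

Lemma tscaleA c d x : tscale c (tscale d x) = tscale (c * d) x.
Proof.
move: x; apply: tensor_ext => [x y|x y|r s]; rewrite ?tscaleDr //.
by rewrite !tscaleE scalerA.
Qed.

Lemma tscale1 : left_id 1 tscale.
Proof.
by apply: tensor_ext => [x y|x y|r s]; rewrite ?tscaleDr ?tscaleE ?scale1r.
Qed.

Lemma tscaleDl x : {morph tscale^~ x : c d / c + d}.
Proof.
move=> c d; move: x; apply: tensor_ext => [x y|x y|r s]; rewrite ?tscaleDr //.
  by rewrite addrACA.
by rewrite !tscaleE scalerDl tensDl.
Qed.

HB.instance Definition _ :=
  GRing.Zmodule_isLmodule.Build k T tscaleA tscale1 tscaleDr tscaleDl.

Lemma tensZl c r s : tens (c *: r) s = c *: tens r s.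
Proof. by rewrite -tscaleE. Qed.

Lemma tensZr c r s : tens r (c *: s) = c *: tens r s.
Proof. by rewrite -tens_scale tensZl. Qed.

End TensorLmod.

Lemma ex_linear_form (k : fieldType) (V : lmodType k) (v : V) : v != 0 ->
  exists f : {scalar V}, f v = 1.
Proof.
move=> v0.
pose P (X : set V) := ~ X v /\ forall c x y, X x -> X y -> X (c *: x + y).
have [F FP tF|M [[Mv Ml] Mmax]] := @Zorn_bigcup V P.
  split=> [[X FX Xv]|c x y [X FX Xx] [Y FY Yy]]; first by case: (FP _ FX).
  have [XY|YX] := tF _ _ FX FY.
    by exists Y => //; apply: (FP _ FY).2 => //; exact: XY.
  by exists X => //; apply: (FP _ FX).2 => //; exact: YX.
have M0 : M 0.
  have [[x Mx]|nM] := pselect (exists x, M x).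
    by have := Ml (-1) _ _ Mx Mx; rewrite scaleN1r addNr.
  exfalso; apply: (Mmax [set 0]).
    split=> [x Mx|M0]; first by case: nM; exists x.
    by case: nM; exists 0; exact: M0.
  split=> [/= /eqP|c x y /= -> ->]; first exact/negP.
  by rewrite scaler0 addr0.
have MZ c x : M x -> M (c *: x) by move=> Mx; rewrite -[_ *: _]addr0; exact: Ml.
have MD x y : M x -> M y -> M (x + y) by move=> Mx; rewrite -[x]scale1r; exact: Ml.
have ex x : exists c, M (x - c *: v).
  have [Mx|nMx] := pselect (M x); first by exists 0; rewrite scale0r subr0.
  pose N := [set y | exists c, M (y - c *: x)].
  have [c Mc] : N v.
    apply: contrapT => nNv; apply: (Mmax N).
      split=> [y My|NM]; first by exists 0; rewrite scale0r subr0.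
      by apply/nMx/NM; exists 1; rewrite scale1r subrr.
    split=> // a y z [c Mc] [d Md]; exists (a * c + d).
    have -> : a *: y + z - (a * c + d) *: x = a *: (y - c *: x) + (z - d *: x).
      by rewrite scalerDl scalerBr scalerA opprD addrACA.
    exact: Ml.
  have c0 : c != 0.
    by apply/eqP => c0; apply: Mv; move: Mc; rewrite c0 scale0r subr0.
  exists c^-1; have := MZ (- c^-1) _ Mc.
  by rewrite scalerBr !scaleNr scalerA mulVf // scale1r opprK addrC.
have [f Mf] := choice ex.
have fE x c : M (x - c *: v) -> f x = c.
  move=> Mc; apply/eqP; rewrite -subr_eq0; apply: contrapT => /negP fc0.
  apply: Mv; have := MZ (f x - c)^-1 _ (MD _ _ Mc (MZ (-1) _ (Mf x))).
  rewrite scaleN1r opprB [X in _ *: X]addrC addrA subrK -scalerBl scalerA.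
  by rewrite mulVf // scale1r.
have fl : scalar f.
  move=> c x y; apply: fE; have := Ml c _ _ (Mf x) (Mf y).
  by rewrite scalerBr scalerA addrACA -opprD -scalerDl.
pose fL : {scalar V} := HB.pack f (GRing.isLinear.Build k V k *%R f fl).
exists fL.
by apply: fE; rewrite scale1r subrr.
Qed.

Section TensorAlg.
Context {k : fieldType} {R S : comAlgType k}.
Local Notation T := (tensor R S).
Implicit Types (r : R) (s : S) (x y z : T) (c : k).

Definition tone : T := tens 1 1.

Definition tmul x y : T :=
  tens_lift (fun r s => tens_lift (fun r' s' => tens (r * r') (s * s')) y) x.

Let tmul_in r s : balanced (fun (r' : R) (s' : S) => tens (r * r') (s * s')).
Proof.
split=> [s' r1 r2|r' s1 s2|c r' s']; first by rewrite mulrDr tensDl.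
  by rewrite mulrDr tensDr.
by rewrite -!scalerAr tens_scale.
Qed.

Let tmul_out y :
  balanced (fun r s => tens_lift (fun r' s' => tens (r * r') (s * s')) y).
Proof.
split=> [s r1 r2|r s1 s2|c r s]; move: y; apply: tensor_ext => [y z|y z|r' s'];
  rewrite ?(tens_liftD (tmul_in _ _)) ?(tens_liftE (tmul_in _ _)) //.
- by rewrite addrACA.
- by rewrite mulrDl tensDl.
- by rewrite addrACA.
- by rewrite mulrDl tensDr.
- by rewrite -!scalerAl tens_scale.
Qed.

Let tmulE r s r' s' : tmul (tens r s) (tens r' s') = tens (r * r') (s * s').
Proof. by rewrite /tmul (tens_liftE (tmul_out _)) (tens_liftE (tmul_in _ _)). Qed.

Lemma tmulDl : left_distributive tmul +%R.
Proof. by move=> x y z; exact: tens_liftD (tmul_out z) x y. Qed.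

Lemma tmulDr : right_distributive tmul +%R.
Proof.
move=> x y z; move: x; apply: tensor_ext => [x x'|x x'|r s].
- by rewrite tmulDl.
- by rewrite !tmulDl addrACA.
- by rewrite /tmul !(tens_liftE (tmul_out _)) (tens_liftD (tmul_in _ _)).
Qed.

Lemma tmulC : commutative tmul.
Proof.
move=> x y; move: x; apply: tensor_ext => [x x'|x x'|r s];
  rewrite ?tmulDl ?tmulDr //.
move: y; apply: tensor_ext => [y y'|y y'|r' s']; rewrite ?tmulDl ?tmulDr //.
by rewrite !tmulE mulrC [s * _]mulrC.
Qed.

Lemma tmulA : associative tmul.
Proof.
move=> x y z; move: x; apply: tensor_ext => [x x'|x x'|r s]; rewrite ?tmulDl //.
move: y; apply: tensor_ext => [y y'|y y'|r' s']; rewrite ?(tmulDl, tmulDr) //.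
move: z; apply: tensor_ext => [z z'|z z'|r2 s2]; rewrite ?tmulDr //.
by rewrite !tmulE !mulrA.
Qed.

Lemma tmul1 : left_id tone tmul.
Proof.
apply: tensor_ext => [x y|//|r s]; first exact: tmulDr.
by rewrite tmulE !mul1r.
Qed.

Lemma tone_neq0 : tone != 0.
Proof.
have [f f1] := ex_linear_form (oner_neq0 R).
have [g g1] := ex_linear_form (oner_neq0 S).
have fgB : balanced (fun (r : R) (s : S) => f r * g s).
  split=> [s r r'|r s s'|c r s]; rewrite ?linearD ?mulrDl ?mulrDr //.
  by rewrite !linearZ /= mulrCA mulrA.
apply/eqP => /(congr1 (tens_lift (fun r s => f r * g s))) /eqP.
by rewrite (tens_lift0 fgB) (tens_liftE fgB) f1 g1 mulr1 oner_eq0.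
Qed.

HB.instance Definition _ :=
  GRing.Zmodule_isComNzRing.Build T tmulA tmulC tmul1 tmulDl tone_neq0.

Lemma tensM r s r' s' : tens r s * tens r' s' = tens (r * r') (s * s').
Proof. exact: tmulE. Qed.

Lemma tens11 : tens 1 1 = 1 :> T. Proof. by []. Qed.

Lemma tscaleAl c x y : c *: (x * y) = c *: x * y.
Proof.
move: x; apply: tensor_ext => [x x'|x x'|r s]; rewrite ?(mulrDl, scalerDr) ?mulrDl //.
move: y; apply: tensor_ext => [y y'|y y'|r' s']; rewrite ?(mulrDr, scalerDr) //.
by rewrite -tensZl !tensM -tensZl scalerAl.
Qed.

HB.instance Definition _ := GRing.Lmodule_isLalgebra.Build k T tscaleAl.
HB.instance Definition _ := GRing.Lalgebra_isComAlgebra.Build k T.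

End TensorAlg.

Section TensorMap.
Context {k : fieldType} {R R' S S' : comAlgType k}.
Variables (f : {linear R -> R'}) (g : {linear S -> S'}).

Definition tens_map : tensor R S -> tensor R' S' :=
  tens_lift (fun r s => tens (f r) (g s)).

Lemma tens_map_balanced : balanced (fun r s => tens (f r) (g s)).
Proof.
split=> [s r r'|r s s'|c r s]; first by rewrite linearD tensDl.
  by rewrite linearD tensDr.
by rewrite !linearZ tens_scale.
Qed.

Lemma tens_mapE r s : tens_map (tens r s) = tens (f r) (g s).
Proof. exact: tens_liftE tens_map_balanced r s. Qed.

Lemma tens_mapD : {morph tens_map : x y / x + y}.
Proof. exact: tens_liftD tens_map_balanced. Qed.

End TensorMap.

Section TensorAssoc.
Context {k : fieldType} {R S Q : comAlgType k}.

Definition tens_assoc : tensor R (tensor S Q) -> tensor (tensor R S) Q :=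
  tens_lift (fun r => tens_lift (fun s q => tens (tens r s) q)).

Lemma tens_assoc_in (r : R) :
  balanced (fun (s : S) (q : Q) => tens (tens r s) q).
Proof.
split=> [q s s'|s q q'|c s q]; first by rewrite tensDr tensDl.
  by rewrite tensDr.
by rewrite tensZr tens_scale.
Qed.

Lemma tens_assoc_out : balanced
  (fun (r : R) => tens_lift (fun (s : S) (q : Q) => tens (tens r s) q)).
Proof.
split=> [x r r'|r x y|c r x]; last 2 first.
- exact: tens_liftD (tens_assoc_in r) x y.
- move: x; apply: tensor_ext => [x y|x y|s q];
    rewrite ?scalerDr ?(tens_liftD (tens_assoc_in _)) //.
  by rewrite -tensZl !(tens_liftE (tens_assoc_in _)) tens_scale.
move: x; apply: tensor_ext => [x y|x y|s q];
  rewrite ?(tens_liftD (tens_assoc_in _)) // 1?addrACA //.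
by rewrite !(tens_liftE (tens_assoc_in _)) !tensDl.
Qed.

Lemma tens_assocE r s q : tens_assoc (tens r (tens s q)) = tens (tens r s) q.
Proof.
by rewrite /tens_assoc (tens_liftE tens_assoc_out) (tens_liftE (tens_assoc_in _)).
Qed.

Lemma tens_assocD : {morph tens_assoc : x y / x + y}.
Proof. exact: tens_liftD tens_assoc_out. Qed.

End TensorAssoc.

Section TensorMul.
Context {k : fieldType} {R : comAlgType k}.

Definition tens_mul : tensor R R -> R := tens_lift (fun x y => x * y).

Lemma tens_mul_balanced : balanced (fun x y : R => x * y).
Proof.
split=> [y x x'|x y y'|c x y]; [exact: mulrDl|exact: mulrDr|].
by rewrite -scalerAl scalerAr.
Qed.

Lemma tens_mulE x y : tens_mul (tens x y) = x * y.
Proof. exact: tens_liftE tens_mul_balanced x y. Qed.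

Lemma tens_mulD : {morph tens_mul : x y / x + y}.
Proof. exact: tens_liftD tens_mul_balanced. Qed.

End TensorMul.

Section TensorForm.
Context {k : fieldType} {R S : comAlgType k}.

(* [e (x) id] and [id (x) e], composed with the identifications of
    [k (x) S] with [S] and of [R (x) k] with [R]. *)
Definition tens_forml (e : {scalar R}) : tensor R S -> S :=
  tens_lift (fun r s => e r *: s).
Definition tens_formr (e : {scalar S}) : tensor R S -> R :=
  tens_lift (fun r s => e s *: r).

Lemma tens_forml_balanced (e : {scalar R}) : balanced (fun r (s : S) => e r *: s).
Proof.
split=> [s r r'|r s s'|c r s]; first by rewrite linearD scalerDl.
  by rewrite scalerDr.
by rewrite linearZ /= scalerA mulrC.
Qed.

Lemma tens_formr_balanced (e : {scalar S}) : balanced (fun (r : R) s => e s *: r).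
Proof.
split=> [s r r'|r s s'|c r s]; first by rewrite scalerDr.
  by rewrite linearD scalerDl.
by rewrite [e (_ *: _)]linearZ /= scalerA mulrC.
Qed.

Lemma tens_formlE e r s : tens_forml e (tens r s) = e r *: s.
Proof. exact: tens_liftE (tens_forml_balanced e) r s. Qed.

Lemma tens_formrE e r s : tens_formr e (tens r s) = e s *: r.
Proof. exact: tens_liftE (tens_formr_balanced e) r s. Qed.

Lemma tens_formlD e : {morph tens_forml e : x y / x + y}.
Proof. exact: tens_liftD (tens_forml_balanced e). Qed.

Lemma tens_formrD e : {morph tens_formr e : x y / x + y}.
Proof. exact: tens_liftD (tens_formr_balanced e). Qed.

End TensorForm.

Record sigma_ring (n : nat) (R : comPzRingType) := SigmaRing {
  sigma :> 'I_n -> {rmorphism R -> R};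
  sigma_comm : forall (i j : 'I_n) (x : R), sigma i (sigma j x) = sigma j (sigma i x)
}.

Definition sigma_morph n (R S : comPzRingType)
    (sR : sigma_ring n R) (sS : sigma_ring n S) (f : R -> S) : Prop :=
  forall (j : 'I_n) (x : R), f (sR j x) = sS j (f x).

(* The action of sigma_1^(m_1) ... sigma_n^(m_n); as the sigma_j commute, the
   order of composition is immaterial. *)
Definition sigma_mon n (R : comPzRingType) (sR : sigma_ring n R)
    (m : 'I_n -> nat) (x : R) : R :=
  foldr (fun j => iter (m j) (sR j)) x (enum 'I_n).

Definition sigma_orbit n (R : comPzRingType) (sR : sigma_ring n R)
    (F : set R) : set R :=
  [set y | exists m, exists2 f, F f & y = sigma_mon sR m f].

(* Unlike [proper_ideal], this allows the unit ideal. *)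
Definition is_ideal (R : comPzRingType) (I : set R) : Prop :=
  [/\ I 0, forall x y, I x -> I y -> I (x + y) & forall a x, I x -> I (a * x)].

Definition is_sigma_ideal n (R : comPzRingType) (sR : sigma_ring n R)
    (I : set R) : Prop :=
  is_ideal I /\ forall (j : 'I_n) x, I x -> I (sR j x).

Definition sigma_ideal_gen n (R : comPzRingType) (sR : sigma_ring n R)
    (F : set R) : set R :=
  smallest (is_sigma_ideal sR) F.

Definition fin_sigma_gen_ideal n (R : comPzRingType) (sR : sigma_ring n R)
    (I : set R) : Prop :=
  exists2 F : set R, finite_set F & I = sigma_ideal_gen sR F.

Record sigma_algebra n (k : fieldType) (sk : sigma_ring n k)
    (A : comAlgType k) := SigmaAlgebra {
  sigma_alg_ring :> sigma_ring n A;
  sigma_in_alg : sigma_morph sk sigma_alg_ring (in_alg A)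
}.

Definition is_subalgebra (k : fieldType) (A : comAlgType k) (B : set A) : Prop :=
  [/\ B 1, forall (c : k) x y, B x -> B y -> B (c *: x + y)
    & forall x y, B x -> B y -> B (x * y)].

Definition fin_sigma_gen_algebra n (k : fieldType) (sk : sigma_ring n k)
    (A : comAlgType k) (sA : sigma_algebra sk A) : Prop :=
  exists2 F : set A, finite_set F
    & smallest (@is_subalgebra k A) (sigma_orbit sA F) = setT.

Section TensorSigma.
Context {n : nat} {k : fieldType} {sk : sigma_ring n k} {R S : comAlgType k}.
Variables (sR : sigma_algebra sk R) (sS : sigma_algebra sk S).
Local Notation T := (tensor R S).

Lemma sigma_algZ (A : comAlgType k) (sA : sigma_algebra sk A) j (c : k) (x : A) :
  sA j (c *: x) = sk j c *: sA j x.
Proof.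
by rewrite -mulr_algl rmorphM -[c%:A]/(in_alg A c) -sigma_in_alg mulr_algl.
Qed.

Definition tens_sigma (j : 'I_n) : T -> T :=
  tens_lift (fun r s => tens (sR j r) (sS j s)).

Lemma tens_sigma_balanced j : balanced (fun r s => tens (sR j r) (sS j s)).
Proof.
split=> [s r r'|r s s'|c r s]; first by rewrite rmorphD tensDl.
  by rewrite rmorphD tensDr.
by rewrite !sigma_algZ tens_scale.
Qed.

Lemma tens_sigmaE j r s : tens_sigma j (tens r s) = tens (sR j r) (sS j s).
Proof. exact: tens_liftE (tens_sigma_balanced j) r s. Qed.

Lemma tens_sigmaD j : {morph tens_sigma j : x y / x + y}.
Proof. exact: tens_liftD (tens_sigma_balanced j). Qed.

Lemma tens_sigma_nmod j : nmod_morphism (tens_sigma j).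
Proof.
split; [exact: tens_lift0 (tens_sigma_balanced j)|exact: tens_sigmaD].
Qed.

Lemma tens_sigma_monoid j : monoid_morphism (tens_sigma j).
Proof.
split=> [|x y]; first by rewrite -tens11 tens_sigmaE !rmorph1.
move: x; apply: tensor_ext => [x x'|x x'|r s]; rewrite ?mulrDl ?tens_sigmaD ?mulrDl //.
move: y; apply: tensor_ext => [y y'|y y'|r' s']; rewrite ?mulrDr ?tens_sigmaD ?mulrDr //.
by rewrite tensM !tens_sigmaE tensM !rmorphM.
Qed.

Definition tens_sigma_rmorph j : {rmorphism T -> T} :=
  HB.pack (tens_sigma j)
    (GRing.isNmodMorphism.Build T T (tens_sigma j) (tens_sigma_nmod j))
    (GRing.isMonoidMorphism.Build T T (tens_sigma j) (tens_sigma_monoid j)).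

Lemma tens_sigma_comm i j (x : T) :
  tens_sigma_rmorph i (tens_sigma_rmorph j x) =
  tens_sigma_rmorph j (tens_sigma_rmorph i x).
Proof.
move: x; apply: tensor_ext => [x y|x y|r s]; rewrite ?rmorphD //.
by rewrite /= !tens_sigmaE (sigma_comm sR) (sigma_comm sS).
Qed.

Lemma tens_sigma_in_alg :
  sigma_morph sk (SigmaRing tens_sigma_comm) (in_alg T).
Proof.
move=> j c /=; rewrite -tens11 -!tensZl tens_sigmaE rmorph1.
by rewrite sigma_algZ rmorph1.
Qed.

Definition tens_sigma_algebra : sigma_algebra sk T :=
  SigmaAlgebra tens_sigma_in_alg.

End TensorSigma.

(* A is commutative, so its antipode is automatically multiplicative. *)
Record hopf_algebra (k : fieldType) (A : comAlgType k) := HopfAlgebra {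
  comul : {lrmorphism A -> tensor A A};
  counit : {lrmorphism A -> k | *%R};
  antipode : {lrmorphism A -> A};
  comulA : forall a : A,
    tens_map comul idfun (comul a) = tens_assoc (tens_map idfun comul (comul a));
  counitl : forall a : A,
    tens_forml counit (comul a) = a;
  counitr : forall a : A,
    tens_formr counit (comul a) = a;
  antipodel : forall a : A,
    tens_mul (tens_map antipode idfun (comul a)) = (counit a)%:A;
  antipoder : forall a : A,
    tens_mul (tens_map idfun antipode (comul a)) = (counit a)%:A
}.

(* The image of [I (x) A + A (x) I] in [A (x) A]. *)
Definition tens_ideal (k : fieldType) (A : comAlgType k) (I : set A) :
    set (tensor A A) :=
  [set x | exists2 u : seq (A * A),
     forall p, p \in u -> I p.1 \/ I p.2 & x = \sum_(p <- u) tens p.1 p.2].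

Definition is_hopf_ideal (k : fieldType) (A : comAlgType k)
    (H : hopf_algebra A) (I : set A) : Prop :=
  [/\ is_ideal I,
      forall a, I a -> tens_ideal I (comul H a),
      forall a, I a -> counit H a = 0
    & forall a, I a -> I (antipode H a)].

Record sigma_hopf_algebra n (k : fieldType) (sk : sigma_ring n k)
    (A : comAlgType k) := SigmaHopfAlgebra {
  sigma_hopf :> hopf_algebra A;
  sigma_hopf_alg :> sigma_algebra sk A;
  sigma_comul :
    sigma_morph sigma_hopf_alg (tens_sigma_algebra sigma_hopf_alg sigma_hopf_alg)
      (comul sigma_hopf);
  sigma_counit : sigma_morph sigma_hopf_alg sk (counit sigma_hopf);
  sigma_antipode :
    sigma_morph sigma_hopf_alg sigma_hopf_alg (antipode sigma_hopf)
}.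

Definition is_sigma_hopf_ideal n (k : fieldType) (sk : sigma_ring n k)
    (A : comAlgType k) (H : sigma_hopf_algebra sk A) (I : set A) : Prop :=
  is_sigma_ideal H I /\ is_hopf_ideal H I.

(* Main.v *)
Require Import Defs.
From HB Require Import structures.
From mathcomp Require Import all_boot all_algebra.
From mathcomp Require Import boolp classical_sets functions cardinality.

(** Geometrically, a Hopf ideal of [A] is a closed subgroup, and the elements of
    the free monoid generated by the [sigma j] act on coordinates.  Choose
    coordinates [x_1, ..., x_m] of [A] whose span is a subcoalgebra and order
    the exponents [t] lexicographically.  The algebras [A_(<t)] and [A_(<=t)]
    generated by the [s(x_i)] with [s < t], respectively [s <= t], are
    subbialgebras, so [G = V(I)] projects to groups [G_(<t)] and [G_(<=t)], and
    the kernel of [G_(<=t) -> G_(<t)] is cut out by the ideal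
    [I + A_(<t)^+ A], where the exponent + means elements of counit 0.

    The theorem comes from two facts.

    Kernels are finitely determined.  Order the monomials in the [m] coordinates
    [t(x_i)] as well, and call a pair [(t, al)] leading if the monomial with
    exponent [al] in the [t(x_i)] agrees, modulo [I + A_(<t)^+ A], with a
    combination of smaller ones.  Since the leading coefficient is
    normalised to 1, it survives the endomorphisms although these twist the
    other coefficients; hence the set of leading pairs is stable under addition
    ([leading_shift]) and, by Dickson's lemma, is governed by finitely many
    elements of [I] ([ex_leading_generators]).  Any sigma-ideal inside [I] that
    contains these elements has the same kernels as [I]
    ([modulo_of_leading]).  A finite subcoalgebra stable under the antipode
    carries them, and the elements of [I] in it generate a sigma-Hopf ideal [I']
    ([ex_fin_gen_hopf_subideal]).

    A group is determined by its quotient and its kernel.  Knowing that [I]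
    and [I'] agree on [A_(<t)] and have the same kernel at [t], one concludes
    that they agree on [A_(<=t)] ([hopf_ideals_agree]), and well-founded
    induction on [t] gives [I = I'].  The usual argument for this step uses the
    faithful flatness of a commutative Hopf algebra over a Hopf subalgebra.
    Here is a substitute.  Let [C = A_(<t)] and let [f] be in [I] and in
    [A_(<=t)].  The shear map [a (x) b |-> a S(b_1) (x) b_2] shows that
    [1 (x) f] vanishes in the tensor product of [A/I] and [A/I'] over [C].
    A determinant argument ([mccoy_relation]) turns this into one element
    [mu] of [C], nonzero modulo [I], that kills modulo [I'] all the left tensor
    factors of [Delta f], of which [f] is a combination ([torsion_family]); they
    too lie in [I] and in [A_(<=t)].  Their annihilator is stable under the coaction ([annihilator_rcontract]); as
    it contains [mu], it contains an element [p] of [C] with counit 1, and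
    finally also [p_1 S(p_2) = 1]. *)

Set Implicit Arguments.
Unset Strict Implicit.
Unset Printing Implicit Defensive.

Import GRing.Theory.

Local Open Scope classical_set_scope.
Local Open Scope ring_scope.

(** * Exponent vectors: lexicographic order and Dickson finiteness *)

Section Exponents.
Variable I : finType.
Implicit Types (a b c : {ffun I -> nat}) (cs : seq I) (X : set {ffun I -> nat}).

Definition expo_add a b : {ffun I -> nat} := [ffun i => (a i + b i)%N].

Fixpoint lex cs a b : bool :=
  if cs is i :: cs' then (a i < b i)%N || ((a i == b i) && lex cs' a b)
  else false.

Definition lexlt := lex (enum I).

Lemma lexlt_trans : transitive lexlt.
Proof.
move=> b a c; rewrite /lexlt; elim: (enum I) => //= i cs IH.
case/orP=> [ab|/andP[/eqP-> ab]]; case/orP=> [bc|/andP[/eqP bc bc']].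
- by rewrite (ltn_trans ab bc).
- by rewrite -bc ab.
- by rewrite bc.
- by rewrite bc eqxx (IH ab bc') orbT.
Qed.

Lemma lexlt_total a b : [\/ lexlt a b, a = b | lexlt b a].
Proof.
have : [\/ lexlt a b, {in enum I, a =1 b} | lexlt b a].
  rewrite /lexlt; elim: (enum I) => [|i cs IH] /=; first exact: Or32.
  have [ab|ab|ab] := ltngtP (a i) (b i); [by apply: Or31|by apply: Or33|].
  case: IH => [?|eq_ab|?]; [by apply: Or31| |by apply: Or33].
  by apply: Or32 => j; rewrite inE => /orP[/eqP->|/eq_ab].
case=> [?|eq_ab|?]; [by apply: Or31| |by apply: Or33].
by apply: Or32; apply/ffunP => i; apply: eq_ab; rewrite mem_enum.
Qed.

Lemma lexlt_addl c a b : lexlt (expo_add c a) (expo_add c b) = lexlt a b.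
Proof.
rewrite /lexlt; elim: (enum I) => //= i cs ->.
by rewrite !ffunE ltn_add2l eqn_add2l.
Qed.

Lemma nat_min (P : nat -> Prop) : (exists m, P m) ->
  exists2 m, P m & forall j, P j -> (m <= j)%N.
Proof.
move=> exP; have exb : exists m, `[< P m >] by case: exP => m ?; exists m; apply/asboolP.
case: (ex_minnP exb) => m /asboolP Pm le_m; exists m => // j Pj.
by apply: le_m; apply/asboolP.
Qed.

Lemma lexlt_min X : X !=set0 -> exists2 a, X a & forall b, X b -> ~~ lexlt b a.
Proof.
rewrite /lexlt; elim: (enum I) X => [|i cs IH] X [a0 Xa0] /=; first by exists a0.
have [|m [a1 Xa1 a1m] le_m] := @nat_min (fun m => exists2 a, X a & a i = m).
  by exists (a0 i), a0.
have [|a [Xa am] min_a] := IH [set a | X a /\ a i = m]; first by exists a1.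
exists a => // b Xb; rewrite am; apply/negP => /orP[|/andP[/eqP bm]].
  by rewrite ltnNge le_m //; exists b.
by apply/negP; exact: min_a.
Qed.

(** Induction on the coordinates, classically: a finite set that lies below
    [X] on the other coordinates deals with every exponent whose coordinate
    [i] is at least the maximum [c] of that coordinate over the set, and the
    finitely many slices [a i = v] with [v < c] are treated separately. *)
Lemma dickson X : exists2 s : seq {ffun I -> nat}, {in s, forall a, X a} &
  forall a, X a -> exists2 b, b \in s & forall i, (b i <= a i)%N.
Proof.
suff [s sX Xs] : exists2 s : seq {ffun I -> nat}, {in s, forall a, X a} &
    forall a, X a -> exists2 b, b \in s & {in enum I, forall i, (b i <= a i)%N}.
  by exists s => // a /Xs[b bs le_b]; exists b => // i; rewrite le_b ?mem_enum.
elim: (enum I) X => [|i cs IH] X.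
  have [[a Xa]|nX] := pselect (X !=set0); last by exists [::] => // a Xa; case: nX; exists a.
  exists [:: a] => [b|b _]; first by rewrite inE => /eqP->.
  by exists a; rewrite ?inE.
have [s0 s0X Xs0] := IH X.
pose c := (\max_(b <- s0) b i)%N.
have [v|t tP] := @choice _ _ (fun v (t : seq {ffun I -> nat}) =>
    {in t, forall a, X a /\ a i = v} /\ forall a, X a -> a i = v ->
      exists2 b, b \in t & {in cs, forall j, (b j <= a j)%N}).
  have [t tX Xt] := IH [set a | X a /\ a i = v].
  by exists t; split=> // a Xa av; exact: Xt.
exists (s0 ++ flatten [seq t v | v <- iota 0 c]) => [a|a Xa].
  rewrite mem_cat => /orP[/s0X //|/flatten_mapP[v _]].
  by case: (tP v) => tX _ /tX[].
have [lt_a|le_a] := ltnP (a i) c.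
  have [_ /(_ a Xa erefl)[b bt le_b]] := tP (a i).
  exists b; first by rewrite mem_cat; apply/orP; right; apply/flatten_mapP; exists (a i); rewrite ?mem_iota.
  move=> j; rewrite inE => /orP[/eqP->|/le_b //].
  by case: (tP (a i)) => /(_ b bt)[_ ->].
have [b bs le_b] := Xs0 _ Xa; exists b; first by rewrite mem_cat bs.
move=> j; rewrite inE => /orP[/eqP->|/le_b //].
by apply: leq_trans le_a; rewrite /c (big_rem b) //= leq_maxl.
Qed.

End Exponents.

(** * Subspaces, linear forms and dual systems *)

Section Subspaces.
Context {k : fieldType} {V : lmodType k}.
Implicit Types (M D : set V) (x y v : V).

Definition subspace M : Prop :=
  M 0 /\ forall (c : k) x y, M x -> M y -> M (c *: x + y).

Section Closure.
Variable M : set V.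
Hypothesis M_sub : subspace M.

Lemma subspace0 : M 0. Proof. exact: M_sub.1. Qed.

Lemma subspaceD x y : M x -> M y -> M (x + y).
Proof. by move=> Mx My; rewrite -[x]scale1r; exact: M_sub.2. Qed.

Lemma subspaceZ (c : k) x : M x -> M (c *: x).
Proof. by move=> Mx; rewrite -[_ *: _]addr0; apply: M_sub.2 => //; exact: subspace0. Qed.

Lemma subspaceN x : M x -> M (- x).
Proof. by rewrite -scaleN1r; exact: subspaceZ. Qed.

Lemma subspaceB x y : M x -> M y -> M (x - y).
Proof. by move=> Mx /subspaceN; exact: subspaceD. Qed.

Lemma subspace_sum (T : Type) (s : seq T) (P : pred T) (F : T -> V) :
  (forall t, P t -> M (F t)) -> M (\sum_(t <- s | P t) F t).
Proof.
by move=> MF; apply: (big_ind M) => //; [exact: subspace0|exact: subspaceD].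
Qed.

Lemma subspace_sum_seq (T : eqType) (s : seq T) (F : T -> V) :
  {in s, forall t, M (F t)} -> M (\sum_(t <- s) F t).
Proof. by move=> MF; rewrite big_seq; exact: subspace_sum. Qed.

End Closure.

Lemma subspace_set0 : subspace [set (0 : V)].
Proof. by split=> // c x y /= -> ->; rewrite scaler0 addr0. Qed.

Lemma scalar_pack (f : V -> k) : scalar f -> exists g : {scalar V}, g =1 f.
Proof.
move=> fl; pose g : {scalar V} := HB.pack f (GRing.isLinear.Build k V k *%R f fl).
by exists g.
Qed.

(** A subspace that is maximal among those containing [M] but not [v] is a
    complement of the line through [v]; the form is the coordinate along that
    line. *)
Lemma ex_scalar_vanishing M v : subspace M -> ~ M v ->
  exists2 f : {scalar V}, f v = 1 & forall x, M x -> f x = 0.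
Proof.
move=> M_sub Mv.
(* The union with M makes the empty chain harmless. *)
pose P X := ~ (X `|` M) v /\ subspace (X `|` M).
have [F FP F_tot|X [[nv N_sub] X_max]] := @Zorn_bigcup V P.
  have inF X x : F X -> (X `|` M) x -> ((\bigcup_(Y in F) Y) `|` M) x.
    by move=> FX [Xx|?]; [left; exists X|right].
  split=> [[[X FX Xv]|//]|]; first by case: (FP _ FX) => nXv _; apply: nXv; left.
  split=> [|c x y]; first by right; exact: subspace0.
  case=> [[X FX Xx]|Mx] [[Y FY Yy]|My].
  - have [XY|YX] := F_tot _ _ FX FY.
      by apply: (inF Y) => //; apply: (FP _ FY).2.2; left => //; exact: XY.
    by apply: (inF X) => //; apply: (FP _ FX).2.2; left => //; exact: YX.
  - by apply: (inF X) => //; apply: (FP _ FX).2.2; [left|right].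
  - by apply: (inF Y) => //; apply: (FP _ FY).2.2; [right|left].
  - by right; exact: M_sub.2.
set N := X `|` M in nv N_sub.
have ex x : exists c, N (x - c *: v).
  have [Nx|nNx] := pselect (N x); first by exists 0; rewrite scale0r subr0.
  pose Y := [set y | exists c, N (y - c *: x)].
  have NY y : N y -> Y y by exists 0; rewrite scale0r subr0.
  have Y_sub : subspace Y.
    split=> [|a y z [c Nc] [d Nd]]; first exact: NY (subspace0 N_sub).
    exists (a * c + d).
    suff -> : a *: y + z - (a * c + d) *: x = a *: (y - c *: x) + (z - d *: x).
      exact: N_sub.2.
    by rewrite scalerDl scalerBr scalerA opprD addrACA.
  have YM : Y `|` M = Y by apply: setUidl => y My; apply: NY; right.
  have [c Nc] : Y v.
    apply: contrapT => nYv; apply: (X_max Y); last by rewrite /P YM.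
    split=> [y Xy|YX]; first by apply: NY; left.
    by apply: nNx; left; apply: YX; exists 1; rewrite scale1r subrr; exact: subspace0.
  have c0 : c != 0 by apply/eqP => c0; apply: nv; rewrite c0 scale0r subr0 in Nc.
  exists c^-1; have := subspaceZ N_sub (- c^-1) Nc.
  by rewrite scalerBr !scaleNr scalerA mulVf // scale1r opprK addrC.
have [f fP] := choice ex.
have fE x c : N (x - c *: v) -> f x = c.
  move=> Nc; apply: contrapT => /eqP; rewrite -subr_eq0 => fc0; apply: nv.
  rewrite -[v]scale1r -(mulVf fc0) -scalerA scalerBl; apply: subspaceZ => //.
  suff -> : f x *: v - c *: v = (x - c *: v) - (x - f x *: v) by exact: subspaceB.
  by rewrite opprB [RHS]addrC subrKA.
have [|g gE] := @scalar_pack f.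
  move=> a x y; apply: fE.
  suff -> : a *: x + y - (a * f x + f y) *: v = a *: (x - f x *: v) + (y - f y *: v).
    by apply: N_sub.2; exact: fP.
  by rewrite scalerDl scalerBr scalerA opprD addrACA.
exists g => [|x Mx]; rewrite gE; apply: fE.
  by rewrite scale1r subrr; exact: subspace0.
by rewrite scale0r subr0; right.
Qed.

(** A basis of the span of [ys] modulo [M], together with a dual family of
    forms defined on the whole space. Having global forms that kill [M] makes
    it possible to test membership in [M] inside a tensor factor by
    contraction. *)
Lemma dual_system M D (ys : seq V) : subspace M -> subspace D ->
    {in ys, forall y, D y} ->
  exists m (w : 'I_m -> V) (l : 'I_m -> {scalar V}),
    [/\ forall i, D (w i), forall i x, M x -> l i x = 0,
        forall i j, l i (w j) = (i == j)%:R
      & {in ys, forall y, M (y - \sum_i l i y *: w i)}].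
Proof.
move=> M_sub D_sub; elim: ys => [|y ys IH] Dys.
  by exists 0, (fun=> 0), (fun i : 'I_0 => False_rect _ (notF (ltn_ord i))); split=> // -[].
have [|m [w [l [Dw Ml lw Mys]]]] := IH.
  by move=> z zs; apply: Dys; rewrite inE zs orbT.
pose r x := x - \sum_i l i x *: w i.
(* r projects along the w i; the next vector and the next form are obtained
   from y and f by composition with r. *)
have lr i x : l i (r x) = 0.
  rewrite linearB linear_sum /= (bigD1 i) //= linearZ /= lw eqxx mulr1 big1 ?addr0 ?subrr //.
  by move=> j ji; rewrite linearZ /= lw eq_sym (negPf ji) mulr0.
have [My|nMy] := pselect (M (r y)).
  by exists m, w, l; split=> // z; rewrite inE => /orP[/eqP->|/Mys].
have rw i : r (w i) = 0.
  rewrite /r (bigD1 i) //= lw eqxx scale1r big1 ?addr0 ?subrr // => j ji.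
  by rewrite lw (negPf ji) scale0r.
have rM x : M x -> r x = x.
  by move=> Mx; rewrite /r big1 ?subr0 // => i _; rewrite Ml // scale0r.
have r_lin : linear r.
  move=> a u v; rewrite /r scalerBr scaler_sumr addrACA -opprD -big_split /=.
  by congr (_ - _); apply: eq_bigr => i _; rewrite linearP scalerDl scalerA.
have [f fy fM] := ex_scalar_vanishing M_sub nMy.
have [|g gE] := @scalar_pack (f \o r).
  by move=> a u v; rewrite /= r_lin linearP.
have rr : r (r y) = r y by rewrite {1}/r big1 ?subr0 // => i _; rewrite lr scale0r.
pose w' i := if unlift ord0 i is Some j then w j else r y.
pose l' i := if unlift ord0 i is Some j then l j else g.
have E x : x - \sum_i l' i x *: w' i = r x - g x *: r y.
  rewrite big_ord_recl /w' /l' unlift_none opprD addrCA addrC.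
  by congr (_ - _ - _); apply: eq_bigr => i _; rewrite liftK.
exists m.+1, w', l'; split.
- rewrite /w' => i; case: unliftP => [j _|_]; first exact: Dw.
  apply: subspaceB => //; first by apply: Dys; rewrite inE eqxx.
  by apply: subspace_sum => // j _; exact: subspaceZ.
- move=> i x Mx; rewrite /l'; case: unliftP => [j _|_]; first exact: Ml.
  by rewrite gE /= rM ?fM.
- move=> i j; rewrite /l' /w'; case: unliftP => [i' ->|->]; case: unliftP => [j' ->|->].
  + by rewrite lw (inj_eq lift_inj).
  + by rewrite lr eq_sym (negPf (neq_lift _ _)).
  + by rewrite gE /= rw linear0.
  + by rewrite gE /= rr fy.
- move=> z; rewrite inE E => /orP[/eqP->|/Mys Mz].
    by rewrite gE /= fy scale1r subrr; exact: subspace0.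
  by rewrite gE /= fM // scale0r subr0.
Qed.

End Subspaces.

(** * Sums of pure tensors *)

Lemma morph_sum (U V : zmodType) (f : U -> V) (T : Type) (s : seq T) (P : pred T)
    (F : T -> U) : {morph f : x y / x + y} ->
  f (\sum_(t <- s | P t) F t) = \sum_(t <- s | P t) f (F t).
Proof.
move=> fD; apply: (big_morph f fD).
by apply: (@addrI _ (f 0)); rewrite -fD !addr0.
Qed.

Section PureSums.
Context {k : fieldType} {A : comAlgType k}.
Implicit Types (P Q : set (A * A)) (D I J M : set A) (x y : tensor A A).

Definition pure_sums P : set (tensor A A) :=
  [set x | exists2 u : seq (A * A), forall p, p \in u -> P p
                                  & x = \sum_(p <- u) tens p.1 p.2].

(** The pure tensors that generate [I (x) A + A (x) J]. *)
Definition in_either I J : set (A * A) := [set p | I p.1 \/ J p.2].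

Lemma pure_sums0 P : pure_sums P 0.
Proof. by exists [::]; rewrite ?big_nil. Qed.

Lemma pure_sumsD P x y : pure_sums P x -> pure_sums P y -> pure_sums P (x + y).
Proof.
move=> [u Pu ->] [v Pv ->]; exists (u ++ v); last by rewrite big_cat.
by move=> p; rewrite mem_cat => /orP[/Pu|/Pv].
Qed.

Lemma pure_sums_tens P r s : P (r, s) -> pure_sums P (tens r s).
Proof.
by move=> Prs; exists [:: (r, s)]; rewrite ?big_seq1 // => p; rewrite inE => /eqP->.
Qed.

Lemma pure_sums_sum P (T : eqType) (s : seq T) (F : T -> tensor A A) :
  {in s, forall t, pure_sums P (F t)} -> pure_sums P (\sum_(t <- s) F t).
Proof.
move=> PF; rewrite big_seq; apply: (big_ind (pure_sums P)) => //.
  exact: pure_sums0.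
exact: pure_sumsD.
Qed.

Lemma pure_sums_ord P m (F : 'I_m -> tensor A A) :
  (forall i, pure_sums P (F i)) -> pure_sums P (\sum_i F i).
Proof. by move=> PF; apply: pure_sums_sum => i _. Qed.

Lemma pure_sums_ind P (V : zmodType) (f : tensor A A -> V) (N : set V) :
    {morph f : x y / x + y} -> N 0 -> (forall a b, N a -> N b -> N (a + b)) ->
    (forall r s, P (r, s) -> N (f (tens r s))) ->
  forall x, pure_sums P x -> N (f x).
Proof.
move=> fD N0 ND Nf _ [u Pu ->]; rewrite (morph_sum _ _ _ fD) big_seq.
by apply: (big_ind N) => // -[r s] /Pu; exact: Nf.
Qed.

Lemma sub_pure_sums P Q : P `<=` Q -> pure_sums P `<=` pure_sums Q.
Proof. by move=> PQ x [u Pu ->]; exists u => // p /Pu /PQ. Qed.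

Lemma pure_sumsT x : pure_sums setT x.
Proof. by exists (repr x) => //; exact: tensorE. Qed.

Lemma pure_sumsM P Q (N : set (A * A)) x y :
    (forall p q, P p -> Q q -> N (p.1 * q.1, p.2 * q.2)) ->
  pure_sums P x -> pure_sums Q y -> pure_sums N (x * y).
Proof.
move=> PQN [u Pu ->] [v Qv ->]; rewrite mulr_suml; apply: pure_sums_sum => p pu.
rewrite mulr_sumr; apply: pure_sums_sum => q qv.
by rewrite tensM; apply: pure_sums_tens; apply: PQN; [exact: Pu|exact: Qv].
Qed.

Lemma ideal_subspace I : is_ideal I -> subspace I.
Proof. by case=> I0 ID IM; split=> // c x y Ix Iy; apply: ID => //; rewrite -mulr_algl; exact: IM. Qed.

Lemma ideal_pure_sums I J :
  is_ideal I -> is_ideal J -> is_ideal (pure_sums (in_either I J)).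
Proof.
move=> [_ _ IM] [_ _ JM]; split; [exact: pure_sums0|exact: pure_sumsD|move=> x y].
move/(pure_sumsM _ (pure_sumsT x)); apply=> -[r s] -[r' s'] _ /= [Ir|Js].
  by left; exact: IM.
by right; exact: JM.
Qed.

Lemma tens_formr_either (l : {scalar A}) I J x : subspace I ->
    (forall a, J a -> l a = 0) ->
  pure_sums (in_either I J) x -> I (tens_formr l x).
Proof.
move=> I_sub lJ; apply: (pure_sums_ind (tens_formrD l)).
- exact: subspace0.
- by move=> *; exact: subspaceD.
- move=> r s [/= Ir|/= Js]; rewrite tens_formrE; first exact: subspaceZ.
  by rewrite lJ // scale0r; exact: subspace0.
Qed.

Lemma tens_forml_either (l : {scalar A}) I J x : subspace J ->
    (forall a, I a -> l a = 0) ->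
  pure_sums (in_either I J) x -> J (tens_forml l x).
Proof.
move=> J_sub lI; apply: (pure_sums_ind (tens_formlD l)).
- exact: subspace0.
- by move=> *; exact: subspaceD.
- move=> r s [/= Ir|/= Js]; rewrite tens_formlE; last exact: subspaceZ.
  by rewrite lI // scale0r; exact: subspace0.
Qed.

Lemma tens_formr_setX (l : {scalar A}) D D' x : subspace D ->
  pure_sums (D `*` D') x -> D (tens_formr l x).
Proof.
move=> D_sub; apply: (pure_sums_ind (tens_formrD l)).
- exact: subspace0.
- by move=> *; exact: subspaceD.
- by move=> r s [/= Dr _]; rewrite tens_formrE; exact: subspaceZ.
Qed.

(** Rewriting a tensor of [D (x) D'] in terms of right factors that are
    independent modulo [M]: the left factors are contractions of the tensor
    itself, and the rest has its right factors in [M]. *)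
Lemma tensor_dual_system M D D' x : subspace M -> subspace D' ->
    pure_sums (D `*` D') x ->
  exists m (w : 'I_m -> A) (l : 'I_m -> {scalar A}),
    [/\ forall i, D' (w i), forall i a, M a -> l i a = 0,
        forall i j, l i (w j) = (i == j)%:R
      & exists2 z, pure_sums (D `*` (D' `&` M)) z
                 & x = \sum_i tens (tens_formr (l i) x) (w i) + z].
Proof.
move=> M_sub D'_sub [u Du xE].
have [|m [w [l [Dw lM lw Mu]]]] := @dual_system _ _ M D' (map snd u) M_sub D'_sub.
  by move=> _ /mapP[p pu ->]; case: (Du p pu).
exists m, w, l; split=> //.
exists (\sum_(p <- u) tens p.1 (p.2 - \sum_i l i p.2 *: w i)).
  apply: pure_sums_sum => p pu; apply: pure_sums_tens; have [Dp D'p] := Du p pu.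
  split=> //; split; last by apply: Mu; apply: map_f.
  by apply: subspaceB => //; apply: subspace_sum => // i _; exact: subspaceZ.
have -> : \sum_i tens (tens_formr (l i) x) (w i) =
    \sum_(p <- u) tens p.1 (\sum_i l i p.2 *: w i).
  transitivity (\sum_i \sum_(p <- u) tens p.1 (l i p.2 *: w i)).
    apply: eq_bigr => i _; rewrite xE (morph_sum _ _ _ (tens_formrD (l i))).
    rewrite (morph_sum _ _ _ (tensDl (w i))).
    by apply: eq_bigr => p _; rewrite tens_formrE tens_scale.
  rewrite exchange_big; apply: eq_bigr => p _.
  by rewrite (morph_sum _ _ _ (tensDr p.1)).
rewrite -big_split xE; apply: eq_bigr => p _.
by rewrite /= -tensDr addrC subrK.
Qed.

(** The intersection of [I (x) A + A (x) I] with [D (x) D'] is generated by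
    pure tensors of [D (x) D']. With right factors independent modulo [I], the
    left factors are contractions by forms that kill [I], hence lie in
    [I]. *)
Lemma pure_sums_restrict D D' I x :
    subspace D -> subspace D' -> subspace I ->
    pure_sums (D `*` D') x -> pure_sums (in_either I I) x ->
  pure_sums ((D `*` D') `&` in_either I I) x.
Proof.
move=> D_sub D'_sub I_sub Dx Ix.
have [m [w [l [Dw lI _ [z Dz ->]]]]] := tensor_dual_system I_sub D'_sub Dx.
apply: pure_sumsD.
  apply: pure_sums_ord => i; apply: pure_sums_tens; split.
    by split=> //=; exact: tens_formr_setX Dx.
  by left; apply: (tens_formr_either I_sub (lI i)).
by apply: sub_pure_sums Dz => -[r s] [/= Dr [Ds Is]]; split=> //; right.
Qed.

End PureSums.

(** * Relations over a subring: a theorem of McCoy type *)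

Section McCoy.
Context {R : comNzRingType}.
Implicit Types (I C : set R).

Definition is_subring C : Prop :=
  [/\ C 1, forall x y, C x -> C y -> C (x - y) & forall x y, C x -> C y -> C (x * y)].

Lemma ideal_sum I (T : Type) (s : seq T) (F : T -> R) :
  is_ideal I -> (forall t, I (F t)) -> I (\sum_(t <- s) F t).
Proof. by case=> I0 ID _ IF; apply: (big_ind I). Qed.

Lemma idealB I x y : is_ideal I -> I x -> I y -> I (x - y).
Proof. by case=> _ ID IM Ix Iy; apply: ID => //; rewrite -mulN1r; exact: IM. Qed.

Section Subring.
Variable C : set R.
Hypothesis C_ring : is_subring C.

Lemma subring1 : C 1. Proof. by case: C_ring. Qed.
Lemma subringM x y : C x -> C y -> C (x * y). Proof. by case: C_ring => _ _; exact. Qed.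
Lemma subring0 : C 0.
Proof. by case: C_ring => C1 CB _; rewrite -(subrr 1); exact: CB. Qed.
Lemma subringN x : C x -> C (- x).
Proof. by case: C_ring => _ CB _ Cx; rewrite -sub0r; apply: CB => //; exact: subring0. Qed.
Lemma subringD x y : C x -> C y -> C (x + y).
Proof. by case: C_ring => _ CB _ Cx /subringN; rewrite -{2}[y]opprK; exact: CB. Qed.

Lemma subring_sum (T : Type) (s : seq T) (F : T -> R) :
  (forall t, C (F t)) -> C (\sum_(t <- s) F t).
Proof. by move=> CF; apply: (big_ind C) => //; [exact: subring0|exact: subringD]. Qed.

Lemma subring_sign b : C ((-1) ^+ b).
Proof.
elim: b => [|b IH]; first exact: subring1.
by rewrite exprS mulN1r; exact: subringN.
Qed.

Lemma subring_det r (M : 'M[R]_r) : (forall i j, C (M i j)) -> C (\det M).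
Proof.
move=> CM; apply: subring_sum => s; apply: subringM; first exact: subring_sign.
by apply: (big_ind C) => //; [exact: subring1|exact: subringM].
Qed.

End Subring.

(** Take for [mu] a minor of [a] of maximal size among those outside [I].
    Bordering it by the row [a0] and a column [t] gives a determinant in [I]:
    replacing [a0] by a row of [a] gives a larger minor of [a], and [a0] is a
    combination of these rows modulo [I]. Expanding along the column [t] gives
    the relation. *)
Lemma mccoy_relation I C m N (w : 'I_m -> R) (a0 : 'I_N -> R) (a : 'I_m -> 'I_N -> R) :
    is_ideal I -> ~ I 1 -> is_subring C ->
    (forall t, C (a0 t)) -> (forall i t, C (a i t)) ->
    (forall t, I (a0 t + \sum_i w i * a i t)) ->
  exists mu (nu : 'I_m -> R), [/\ C mu, ~ I mu, forall i, C (nu i)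
    & forall t, I (mu * a0 t - \sum_i nu i * a i t)].
Proof.
move=> I_id I1 C_ring Ca0 Ca rel; have [I0 ID IM] := I_id.
pose minor r (f : 'I_r -> 'I_m) (g : 'I_r -> 'I_N) := \det (\matrix_(i, j) a (f i) (g j)).
pose big r := exists f g, ~ I (@minor r f g).
have big0 : big 0%N.
  by exists (fun i : 'I_0 => False_rect _ (notF (ltn_ord i))), (fun i : 'I_0 => False_rect _ (notF (ltn_ord i))); rewrite /minor det_mx00.
have big_le r : big r -> (r <= m)%N.
  case=> f [g nI]; rewrite leqNgt; apply/negP => lt_mr; apply: nI.
  have /injectivePn[i [j ij fij]] : ~~ injectiveb f.
    by apply/injectiveP => /leq_card; rewrite !card_ord leqNgt lt_mr.
  rewrite /minor (determinant_alternate ij) // => s; by rewrite !mxE fij.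
have [r [f [g nImu]] max_r] : exists2 r, big r & ~ big r.+1.
  apply: contrapT => nex; suff /(_ m.+1)/big_le : forall r, big r by rewrite ltnn.
  by elim=> // r br; apply: contrapT => nbr; apply: nex; exists r.
(* The minor mu bordered by the row h and the column t. *)
pose ext (h : 'I_N -> R) t : 'M[R]_r.+1 := \matrix_(i, j)
  (if unlift ord0 i is Some i' then a (f i') else h)
  (if unlift ord0 j is Some j' then g j' else t).
have row0 h t : \det (ext h t) =
    \sum_j h (if unlift ord0 j is Some j' then g j' else t) * cofactor (ext a0 t) ord0 j.
  rewrite (expand_det_row _ ord0); apply: eq_bigr => j _; rewrite !mxE unlift_none.
  congr (_ * (_ * \det _)); apply/matrixP => i' j'; rewrite !mxE.
  by rewrite liftK.
(* The columns of the chosen minor under the border; their cofactors do not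
   depend on t. *)
pose under : 'M[R]_(r.+1, r) := \matrix_(i, j)
  (if unlift ord0 i is Some i' then a (f i') else a0) (g j).
pose cof i : R := (-1) ^+ (lift ord0 i + @ord0 r) * \det (row' (lift ord0 i) under).
have col0 t : \det (ext a0 t) = minor r f g * a0 t + \sum_i cof i * a (f i) t.
  rewrite (expand_det_col _ ord0) big_ord_recl !mxE unlift_none mulrC; congr (_ * _ + _).
    rewrite /cofactor expr0 mul1r; congr (\det _).
    by apply/matrixP => i j; rewrite !mxE !liftK.
  apply: eq_bigr => i _; rewrite !mxE liftK unlift_none mulrC; congr (_ * \det _ * _).
  by apply/matrixP => i' j'; rewrite !mxE liftK.
have I_ext t : I (\det (ext a0 t)).
  pose g' j := if unlift ord0 j is Some j' then g j' else t.
  have -> : \det (ext a0 t) =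
      \sum_j cofactor (ext a0 t) ord0 j * (a0 (g' j) + \sum_i w i * a i (g' j)) -
      \sum_i w i * \det (ext (a i) t).
    rewrite row0; apply/eqP; rewrite eq_sym subr_eq; apply/eqP.
    under [X in _ = _ + X]eq_bigr do rewrite row0 mulr_sumr.
    rewrite exchange_big -big_split /=; apply: eq_bigr => j _.
    rewrite mulrDr mulrC mulr_sumr; congr (_ + _).
    by apply: eq_bigr => i _; rewrite mulrA mulrC.
  apply: idealB => //; apply: ideal_sum => // i; apply: IM => //.
  apply: contrapT => nIi; apply: max_r.
  exists (fun k => if unlift ord0 k is Some k' then f k' else i), g'.
  suff -> : minor r.+1 (fun k => if unlift ord0 k is Some k' then f k' else i) g' =
    \det (ext (a i) t) by [].
  by congr (\det _); apply/matrixP => k j; rewrite !mxE; case: unliftP.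
exists (minor r f g), (fun i => - \sum_(l | f l == i) cof l); split=> //.
- by apply: subring_det => // i j; rewrite mxE.
- move=> i; apply: subringN => //; rewrite big_mkcond; apply: subring_sum => // l.
  case: ifP => _; last exact: subring0.
  apply: subringM => //; first exact: subring_sign.
  by apply: subring_det => // i' j'; rewrite !mxE; case: unliftP.
- move=> t; suff -> : minor r f g * a0 t - \sum_i (- \sum_(l | f l == i) cof l) * a i t
      = \det (ext a0 t) by exact: I_ext.
  rewrite col0 -sumrN; congr (_ + _).
  rewrite (partition_big f predT) //=; apply: eq_bigr => i _.
  by rewrite mulNr opprK mulr_suml; apply: eq_bigr => l /eqP ->.
Qed.

End McCoy.

(** * Comatrices *)

Section TensMapAlgebra.
Context {k : fieldType} {A B A' B' : comAlgType k}.

Lemma tens0l (s : B) : tens (0 : A) s = 0.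
Proof. by rewrite -(scale0r (0 : A)) tensZl scale0r. Qed.

Lemma tens0r (r : A) : tens r (0 : B) = 0.
Proof. by rewrite -(scale0r (0 : B)) tensZr scale0r. Qed.

Lemma tens_formrZ (l : {scalar B}) (c : k) (x : tensor A B) :
  tens_formr l (c *: x) = c *: tens_formr l x.
Proof.
move: x; apply: tensor_ext => [x y|x y|r s]; rewrite ?scalerDr ?tens_formrD ?scalerDr //.
by rewrite -tensZl !tens_formrE !scalerA mulrC.
Qed.

Lemma tens_formlZ (l : {scalar A}) (c : k) (x : tensor A B) :
  tens_forml l (c *: x) = c *: tens_forml l x.
Proof.
move: x; apply: tensor_ext => [x y|x y|r s]; rewrite ?scalerDr ?tens_formlD ?scalerDr //.
by rewrite -tensZr !tens_formlE !scalerA mulrC.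
Qed.

HB.instance Definition _ (l : {scalar B}) :=
  GRing.isLinear.Build k (tensor A B) A *:%R (tens_formr l)
    (fun c x y => etrans (tens_formrD l _ _) (congr1 (+%R^~ _) (tens_formrZ l c x))).

HB.instance Definition _ (l : {scalar A}) :=
  GRing.isLinear.Build k (tensor A B) B *:%R (tens_forml l)
    (fun c x y => etrans (tens_formlD l _ _) (congr1 (+%R^~ _) (tens_formlZ l c x))).

Lemma tens_mapZ (f : {linear A -> A'}) (g : {linear B -> B'}) (c : k) (x : tensor A B) :
  tens_map f g (c *: x) = c *: tens_map f g x.
Proof.
move: x; apply: tensor_ext => [x y|x y|r s]; rewrite ?scalerDr ?tens_mapD ?scalerDr //.
by rewrite -tensZl !tens_mapE linearZ tensZl.
Qed.

Lemma tens_mapM (f : {lrmorphism A -> A'}) (g : {lrmorphism B -> B'}) :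
  {morph tens_map f g : x y / x * y}.
Proof.
move=> x y; move: x; apply: tensor_ext => [x x'|x x'|r s];
  rewrite ?mulrDl ?tens_mapD ?mulrDl //.
move: y; apply: tensor_ext => [y y'|y y'|r' s'];
  rewrite ?mulrDr ?tens_mapD ?mulrDr //.
by rewrite tensM !tens_mapE tensM !rmorphM.
Qed.

End TensMapAlgebra.

Section Comatrix.
Context {k : fieldType} {A : comAlgType k}.
Variable H : hopf_algebra A.
Local Notation Delta := (comul H).
Local Notation eps := (counit H).
Local Notation S := (antipode H).
Implicit Types (a b : A) (l : {scalar A}) (E : seq A).

(** [rcontract l] and [lcontract l] are the maps [a |-> a_1 l(a_2)] and
    [a |-> l(a_1) a_2]; coassociativity says that they commute with the
    comultiplication on the other side. *)
Definition rcontract l : {linear A -> A} := tens_formr l \o Delta.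
Definition lcontract l : {linear A -> A} := tens_forml l \o Delta.

Lemma comul_rcontract l a :
  Delta (rcontract l a) = tens_map idfun (rcontract l) (Delta a).
Proof.
transitivity (tens_formr l (tens_map Delta idfun (Delta a))).
  rewrite /=; move: (Delta a); apply: tensor_ext => [x y|x y|r s].
  - by rewrite tens_formrD raddfD.
  - by rewrite tens_mapD tens_formrD.
  - by rewrite tens_mapE !tens_formrE linearZ.
rewrite comulA; move: (Delta a); apply: tensor_ext => [x y|x y|r s].
- by rewrite tens_mapD tens_assocD tens_formrD.
- exact: tens_mapD.
rewrite !tens_mapE /=; move: (Delta s); apply: tensor_ext => [x y|x y|p q].
- by rewrite tensDr tens_assocD tens_formrD.
- by rewrite tens_formrD tensDr.
- by rewrite tens_assocE !tens_formrE tensZr.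
Qed.

Lemma comul_lcontract l a :
  Delta (lcontract l a) = tens_map (lcontract l) idfun (Delta a).
Proof.
transitivity (tens_map (tens_forml l) idfun (tens_map Delta idfun (Delta a))).
  rewrite comulA /=; move: (Delta a); apply: tensor_ext => [x y|x y|r s].
  - by rewrite tens_formlD raddfD.
  - by rewrite tens_mapD tens_assocD tens_mapD.
  rewrite tens_mapE tens_formlE linearZ /=; move: (Delta s).
  apply: tensor_ext => [x y|x y|p q].
  - by rewrite scalerDr.
  - by rewrite tensDr tens_assocD tens_mapD.
  - by rewrite tens_assocE tens_mapE /= tens_formlE tensZl.
move: (Delta a); apply: tensor_ext => [x y|x y|r s].
- by rewrite !tens_mapD.
- by rewrite tens_mapD.
- by rewrite !tens_mapE.
Qed.

Lemma counit_lcontract l a : eps (lcontract l a) = l a.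
Proof.
rewrite -[in RHS](counitr H a) /=; move: (Delta a).
apply: tensor_ext => [x y|x y|r s]; rewrite ?(tens_formlD, tens_formrD) ?raddfD //.
by rewrite tens_formlE tens_formrE [LHS]linearZ [RHS]linearZ /= mulrC.
Qed.

(** Coordinates of a matrix representation: a comatrix is multiplicative under
    the comultiplication, so that the antipode inverts it as a matrix. *)
Definition is_comatrix N (z : 'M[A]_N) : Prop :=
  (forall i j, Delta (z i j) = \sum_l tens (z i l) (z l j)) /\
  (forall i j, eps (z i j) = (i == j)%:R).

(** The left tensor factors of [Delta a] span a finite-dimensional right
    coideal containing [a]; for a basis [v] of it, the coefficients in
    [Delta (v j) = \sum_i tens (v i) (z i j)] form a comatrix, and [v j],
    hence [a], is a combination of its entries by counitality. Being such a
    combination is expressed by all the subspaces that contain the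
    entries. *)
Lemma comatrix_coefficients a : exists N (z : 'M[A]_N), is_comatrix z /\
  forall M : set A, subspace M -> (forall i j, M (z i j)) -> M a.
Proof.
have setT_sub : subspace [set: A] by [].
have DaT : pure_sums (setT `*` setT) (Delta a).
  by have := pure_sumsT (Delta a); apply: sub_pure_sums.
have [m [w [l [_ _ _ [z0 z00 Da]]]]] :=
  tensor_dual_system (@subspace_set0 k A) setT_sub DaT.
have {z0 z00 Da} Da : Delta a = \sum_i tens (rcontract (l i) a) (w i).
  rewrite {1}Da; suff -> : z0 = 0 by rewrite addr0.
  move: z0 z00 {Da}; apply: (pure_sums_ind (f := id) (N := [set 0])) => //= [a1 a2 -> ->|r s].
    by rewrite addr0.
  by case=> _ [_ /= ->]; rewrite tens0r.
pose b i := rcontract (l i) a.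
have Db i : Delta (b i) = \sum_j tens (b j) (rcontract (l i) (w j)).
  rewrite comul_rcontract Da (morph_sum _ _ _ (tens_mapD _ _)).
  by apply: eq_bigr => j _; rewrite tens_mapE.
have ab : a = \sum_i eps (w i) *: b i.
  rewrite -{1}(counitr H a) Da linear_sum.
  by apply: eq_bigr => i _; rewrite /= tens_formrE.
(* The coideal D spanned by the b i is defined by these possibly dependent
   generators; its basis v is extracted below. *)
pose D : set A := [set x | exists c : 'I_m -> k, x = \sum_i c i *: b i].
have D_sub : subspace D.
  split=> [|c x y [cx ->] [cy ->]].
    by exists (fun=> 0); rewrite big1 // => i _; rewrite scale0r.
  exists (fun i => c * cx i + cy i); rewrite scaler_sumr -big_split.
  by apply: eq_bigr => i _; rewrite scalerDl scalerA.
have Db_in i : D (b i).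
  exists (fun j => (j == i)%:R); rewrite (bigD1 i) //= eqxx scale1r big1 ?addr0 //.
  by move=> j /negPf->; rewrite scale0r.
have DD x : D x -> pure_sums (D `*` setT) (Delta x).
  case=> c ->; rewrite linear_sum; apply: pure_sums_ord => i.
  rewrite linearZ /= Db scaler_sumr; apply: pure_sums_ord => j.
  by rewrite -tensZr; apply: pure_sums_tens; split=> //; exact: Db_in.
have [|N [v [lam [Dv _ lv bv]]]] :=
  @dual_system _ _ [set 0] D [seq b i | i <- enum 'I_m] (@subspace_set0 _ _) D_sub.
  by move=> _ /mapP[i _ ->].
have Dlam x : D x -> x = \sum_i lam i x *: v i.
  case=> c ->; under [RHS]eq_bigr do rewrite linear_sum scaler_suml.
  rewrite exchange_big; apply: eq_bigr => i _.
  have /= /eqP := bv (b i) (map_f _ (mem_enum _ i)); rewrite subr_eq0 => /eqP {1}->.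
  by rewrite scaler_sumr; apply: eq_bigr => j _; rewrite scalerA [in RHS]linearZ.
pose z : 'M[A]_N := \matrix_(i, j) lcontract (lam i) (v j).
have Dv_z j : Delta (v j) = \sum_i tens (v i) (z i j).
  under eq_bigr do rewrite mxE.
  apply/eqP; rewrite -subr_eq0; apply/eqP; rewrite /=.
  move: (Delta (v j)) (DD _ (Dv j)).
  apply: (pure_sums_ind (N := [set 0])) => [x y|//|x y -> ->|r s [/= Dr _]].
  - under eq_bigr do rewrite tens_formlD tensDr.
    by rewrite big_split opprD addrACA.
  - by rewrite addr0.
  - rewrite [in X in X - _](Dlam _ Dr) (morph_sum _ _ _ (tensDl _)) -sumrB big1 // => i _.
    by rewrite tens_formlE tens_scale subrr.
exists N, z; split.
  split=> i j; rewrite mxE; last by rewrite counit_lcontract.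
  rewrite comul_lcontract Dv_z (morph_sum _ _ _ (tens_mapD _ _)).
  by apply: eq_bigr => r _; rewrite tens_mapE [z i r]mxE.
move=> M M_sub Mz; have Mv j : M (v j).
  rewrite -(counitl H (v j)) Dv_z linear_sum; apply: subspace_sum => // i _.
  by rewrite /= tens_formlE; exact: subspaceZ.
rewrite ab; apply: subspace_sum => // i _; apply: subspaceZ => //.
by rewrite (Dlam _ (Db_in i)); apply: subspace_sum => // j _; exact: subspaceZ.
Qed.

Lemma comatrix_ind (P : A -> Prop) : subspace P ->
  (forall N (z : 'M[A]_N), is_comatrix z -> forall i j, P (z i j)) -> forall a, P a.
Proof.
by move=> P_sub Pz a; have [N [z [zc za]]] := comatrix_coefficients a; apply: za => //; exact: Pz.
Qed.

(** Identities between linear maps, usually proved by computing with iterated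
    comultiplications, need only be checked on comatrices, where they become
    identities between matrices. *)
Lemma comatrix_eq (V : lmodType k) (f g : A -> V) : linear f -> linear g ->
  (forall N (z : 'M[A]_N), is_comatrix z -> forall i j, f (z i j) = g (z i j)) ->
  f =1 g.
Proof.
move=> f_lin g_lin fgz; apply: comatrix_ind => //; split=> [|c x y fgx fgy].
  have E h : linear h -> h (0 : A) = 0 :> V.
    move=> h_lin; have := h_lin 1 0 0; rewrite !scale1r addr0 => /eqP.
    by rewrite -subr_eq subrr eq_sym => /eqP.
  by rewrite !E.
by rewrite f_lin g_lin fgx fgy.
Qed.

Section Entries.
Context {N : nat} {z : 'M[A]_N}.
Hypothesis zc : is_comatrix z.

Lemma comatrix_antipoder : z *m map_mx S z = 1%:M.
Proof.
apply/matrixP => i j; rewrite !mxE; have := antipoder H (z i j).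
rewrite zc.1 zc.2 (morph_sum _ _ _ (tens_mapD _ _)) (morph_sum _ _ _ tens_mulD).
rewrite scaler_nat => <-.
by apply: eq_bigr => l _; rewrite tens_mapE tens_mulE mxE.
Qed.

Lemma comatrix_antipodel : map_mx S z *m z = 1%:M.
Proof. by rewrite (mulmx1C comatrix_antipoder). Qed.

(** Applying [S] to [z S(z) = 1] shows that [S(S(z))], like [z], is inverse to
    [S(z)]. *)
Lemma comatrix_antipodeK i j : S (S (z i j)) = z i j.
Proof.
have /(congr1 (map_mx S)) := comatrix_antipoder; rewrite map_mxM map_mx1 => SS.
have : map_mx S (map_mx S z) = z.
  by rewrite -[LHS]mul1mx -comatrix_antipoder -mulmxA SS mulmx1.
by move/matrixP/(_ i j); rewrite !mxE.
Qed.

(** Inverting the matrix identity [Delta(z) = (z (x) 1) (1 (x) z)] exchanges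
    the two factors. *)
Lemma comatrix_comul_antipode i j :
  Delta (S (z i j)) = \sum_l tens (S (z l j)) (S (z i l)).
Proof.
pose L (y : 'M[A]_N) := \matrix_(i, j) tens (y i j) (1 : A).
pose R (y : 'M[A]_N) := \matrix_(i, j) tens (1 : A) (y i j).
have LM x y : L x *m L y = L (x *m y).
  apply/matrixP => r s; rewrite !mxE (morph_sum _ _ _ (tensDl 1)).
  by apply: eq_bigr => t _; rewrite !mxE tensM mulr1.
have RM x y : R x *m R y = R (x *m y).
  apply/matrixP => r s; rewrite !mxE (morph_sum _ _ _ (tensDr 1)).
  by apply: eq_bigr => t _; rewrite !mxE tensM mulr1.
have L1 : L 1%:M = 1%:M.
  by apply/matrixP => r s; rewrite !mxE; case: eqP => // _; rewrite tens0l.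
have R1 : R 1%:M = 1%:M.
  by apply/matrixP => r s; rewrite !mxE; case: eqP => // _; rewrite tens0r.
have Dz : map_mx Delta z = L z *m R z.
  apply/matrixP => r s; rewrite !mxE zc.1.
  by apply: eq_bigr => t _; rewrite !mxE tensM mulr1 mul1r.
have DSz : map_mx Delta (map_mx S z) = R (map_mx S z) *m L (map_mx S z).
  have inv : L z *m R z *m (R (map_mx S z) *m L (map_mx S z)) = 1%:M.
    rewrite mulmxA -[L z *m _ *m _]mulmxA RM comatrix_antipoder R1 mulmx1.
    by rewrite LM comatrix_antipoder L1.
  rewrite -[LHS]mulmx1 -inv -Dz !mulmxA -map_mxM comatrix_antipodel.
  by rewrite map_mx1 mul1mx.
have /matrixP/(_ i j) := DSz; rewrite !mxE => ->.
by apply: eq_bigr => l _; rewrite !mxE tensM mulr1 mul1r.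
Qed.

End Entries.

End Comatrix.

(** * Finite subcoalgebras and the shear maps *)

Section Antipode.
Context {k : fieldType} {A : comAlgType k}.
Variable H : hopf_algebra A.
Local Notation Delta := (comul H).
Local Notation S := (antipode H).
Implicit Types (a b : A) (E : seq A).

Definition lin_span E : set A := smallest subspace [set` E].

Lemma lin_span_subspace E : subspace (lin_span E).
Proof.
split=> [M [M_sub _]|c x y Ex Ey M M_E]; first exact: subspace0.
by apply: M_E.1.2; [exact: Ex|exact: Ey].
Qed.

Lemma mem_lin_span E x : x \in E -> lin_span E x.
Proof. by move=> xE M [_]; exact. Qed.

Definition coalg_closed E : Prop :=
  {in E, forall x, pure_sums ([set` E] `*` [set` E]) (Delta x)}.

(** Local finiteness, including stability under the antipode: the entries of a
    comatrix together with their images by [S]. *)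
Lemma ex_finite_coalgebra (gs : seq A) : exists E,
  [/\ coalg_closed E, {in E, forall x, S x \in E} & {in gs, forall g, lin_span E g}].
Proof.
elim: gs => [|g gs [E [E_coalg E_S E_gs]]]; first by exists [::].
have [N [z [zc zg]]] := comatrix_coefficients H g.
pose e := [seq z p.1 p.2 | p <- enum (('I_N * 'I_N)%type : finType)].
have ze i j : z i j \in e by apply/mapP; exists (i, j); rewrite ?mem_enum.
have eP x : x \in e -> exists i j, x = z i j by case/mapP=> -[i j] _ ->; exists i, j.
have sub X Y : {subset X <= Y} -> pure_sums ([set` X] `*` [set` X]) `<=`
    pure_sums (([set` Y] `*` [set` Y]) : set (A * A)).
  by move=> XY; apply: sub_pure_sums => -[r s] /= [/XY ? /XY].
exists (e ++ map S e ++ E); split.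
- move=> x; rewrite !mem_cat => /or3P[|/mapP[y]|xE].
  + case/eP=> i [j ->]; rewrite zc.1; apply: pure_sums_ord => l; apply: pure_sums_tens.
    by split=> /=; rewrite mem_cat ze.
  + case/eP=> i [j ->] ->; rewrite (comatrix_comul_antipode zc); apply: pure_sums_ord => l.
    by apply: pure_sums_tens; split; rewrite /= !mem_cat map_f ?orbT.
  + by apply: sub (E_coalg _ xE) => y yE; rewrite !mem_cat yE !orbT.
- move=> x; rewrite !mem_cat => /or3P[xe|/mapP[y ye ->]|/E_S->]; last by rewrite !orbT.
    by rewrite map_f // orbT.
  by case/eP: ye => i [j ->]; rewrite (comatrix_antipodeK zc) ze.
- move=> x; rewrite inE => /orP[/eqP->|/E_gs gE] M [M_sub sub_M].
    by apply: zg => // i j; apply: sub_M; rewrite /= mem_cat ze.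
  by apply: gE; split=> // y /= yE; apply: sub_M; rewrite /= !mem_cat yE !orbT.
Qed.

Lemma comatrix_antipode_entry N (z : 'M[A]_N) : is_comatrix H z ->
  forall i j, \sum_l z i l * S (z l j) = (i == j)%:R.
Proof.
move=> zc i j; have /matrixP/(_ i j) := comatrix_antipoder zc.
by rewrite !mxE => <-; apply: eq_bigr => l _; rewrite mxE.
Qed.

(** The algebra morphism [a |-> S(a_1) (x) a_2]. *)
Definition antipode_comul_l : A -> tensor A A := tens_map S idfun \o Delta.

(** [a (x) b |-> a S(b_1) (x) b_2] and [a (x) b |-> a_1 (x) a_2 S(b)] are the
    comorphisms of the shear maps [(g, h) |-> (g, g^-1 h)] and
    [(g, h) |-> (g h, h^-1)] of the square of the group; they send [Delta a]
    to [1 (x) a] and to [a (x) 1]. *)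
Definition shear_l : tensor A A -> tensor A A :=
  tens_lift (fun a b => tens a 1 * antipode_comul_l b).

Definition shear_r : tensor A A -> tensor A A :=
  tens_lift (fun a b => Delta a * tens 1 (S b)).

Lemma antipode_comul_lD : {morph antipode_comul_l : x y / x + y}.
Proof. by move=> x y; rewrite /antipode_comul_l /= raddfD tens_mapD. Qed.

Lemma antipode_comul_lZ c x : antipode_comul_l (c *: x) = c *: antipode_comul_l x.
Proof. by rewrite /antipode_comul_l /= linearZ tens_mapZ. Qed.

Lemma antipode_comul_lM : {morph antipode_comul_l : x y / x * y}.
Proof. by move=> x y; rewrite /antipode_comul_l /= rmorphM tens_mapM. Qed.

Lemma shear_l_balanced : balanced (fun a b => tens a 1 * antipode_comul_l b).
Proof.
split=> [b a a'|a b b'|c a b]; first by rewrite tensDl mulrDl.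
  by rewrite antipode_comul_lD mulrDr.
by rewrite antipode_comul_lZ tensZl -scalerAl scalerAr.
Qed.

Lemma shear_r_balanced : balanced (fun a b => Delta a * tens 1 (S b)).
Proof.
split=> [b a a'|a b b'|c a b]; first by rewrite raddfD mulrDl.
  by rewrite raddfD tensDr mulrDr.
by rewrite !linearZ tensZr -scalerAl scalerAr.
Qed.

Lemma shear_lD : {morph shear_l : x y / x + y}. Proof. exact: tens_liftD shear_l_balanced. Qed.
Lemma shear_rD : {morph shear_r : x y / x + y}. Proof. exact: tens_liftD shear_r_balanced. Qed.
Lemma shear_lE a b : shear_l (tens a b) = tens a 1 * antipode_comul_l b.
Proof. exact: tens_liftE shear_l_balanced a b. Qed.
Lemma shear_rE a b : shear_r (tens a b) = Delta a * tens 1 (S b).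
Proof. exact: tens_liftE shear_r_balanced a b. Qed.

Lemma morph_linear (f : tensor A A -> tensor A A) : {morph f : x y / x + y} ->
  (forall c r s, f (c *: tens r s) = c *: f (tens r s)) -> linear (f \o Delta).
Proof.
move=> fD fZ c x y; have fcZ u : f (c *: u) = c *: f u.
  by move: u; apply: tensor_ext => [u v|u v|r s]; rewrite ?scalerDr ?fD ?scalerDr.
by rewrite /= linearP fD fcZ.
Qed.

Lemma shear_l_comul a : shear_l (Delta a) = tens 1 a.
Proof.
suff E : shear_l \o Delta =1 tens (1 : A) by exact: E.
apply: (comatrix_eq (H := H)) => [| |N z zc i j].
- by apply: morph_linear shear_lD _ => c r s; rewrite -tensZl !shear_lE tensZl scalerAl.
- by move=> c x y; rewrite tensDr tensZr.
rewrite /= zc.1 (morph_sum _ _ _ shear_lD).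
transitivity (\sum_l \sum_m tens (z i l * S (z l m)) (z m j)).
  apply: eq_bigr => l _; rewrite shear_lE /antipode_comul_l /= zc.1 (morph_sum _ _ _ (tens_mapD _ _)).
  by rewrite mulr_sumr; apply: eq_bigr => m _; rewrite tens_mapE tensM mul1r.
rewrite exchange_big (eq_bigr (fun m => tens (i == m)%:R (z m j))) => [|m _].
  rewrite (bigD1 i) //= eqxx big1 ?addr0 // => m mi.
  by rewrite eq_sym (negPf mi) tens0l.
by rewrite -(comatrix_antipode_entry zc) (morph_sum _ _ _ (tensDl _)).
Qed.

Lemma shear_r_comul a : shear_r (Delta a) = tens a 1.
Proof.
suff E : shear_r \o Delta =1 (fun b : A => tens b (1 : A)) by exact: E.
apply: (comatrix_eq (H := H)) => [| |N z zc i j].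
- by apply: morph_linear shear_rD _ => c r s; rewrite -tensZl !shear_rE linearZ scalerAl.
- by move=> c x y; rewrite tensDl tensZl.
rewrite /= zc.1 (morph_sum _ _ _ shear_rD).
transitivity (\sum_l \sum_m tens (z i m) (z m l * S (z l j))).
  apply: eq_bigr => l _; rewrite shear_rE zc.1.
  by rewrite mulr_suml; apply: eq_bigr => m _; rewrite tensM mulr1.
rewrite exchange_big (eq_bigr (fun m => tens (z i m) (m == j)%:R)) => [|m _].
  rewrite (bigD1 j) //= eqxx big1 ?addr0 // => m mj.
  by rewrite (negPf mj) tens0r.
by rewrite -(comatrix_antipode_entry zc) (morph_sum _ _ _ (tensDr _)).
Qed.

Lemma shear_r_mull c x : shear_r (tens c 1 * x) = Delta c * shear_r x.
Proof.
move: x; apply: tensor_ext => [x y|x y|r s]; rewrite ?mulrDr ?shear_rD ?mulrDr //.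
by rewrite tensM !shear_rE mul1r rmorphM mulrA.
Qed.

End Antipode.

(** * Comparing two Hopf ideals along a subbialgebra *)

Section Comparison.
Context {k : fieldType} {A : comAlgType k}.
Variable H : hopf_algebra A.
Local Notation Delta := (comul H).
Local Notation eps := (counit H).
Local Notation S := (antipode H).
Implicit Types (a b c d f : A).

Definition ideal_span (X : set A) : set A := smallest (@is_ideal A) X.

Lemma subalgebra_subspace (C : set A) : is_subalgebra C -> subspace C.
Proof.
case=> C1 Cl _; split=> [|c x y]; last exact: Cl.
by have := Cl (-1) 1 1 C1 C1; rewrite scaleN1r addNr.
Qed.

Lemma subalgebra_subring (C : set A) : is_subalgebra C -> is_subring C.
Proof.
move=> C_alg; have C_sub := subalgebra_subspace C_alg.
by case: C_alg => C1 _ CM; split=> // x y; exact: subspaceB.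
Qed.

Lemma tens_formr_mulr (l : {scalar A}) (x : A) (t : tensor A A) :
  tens_formr l (t * tens x 1) = tens_formr l t * x.
Proof.
move: t; apply: tensor_ext => [u v|u v|r s]; rewrite ?mulrDl ?tens_formrD ?mulrDl //.
by rewrite tensM mulr1 !tens_formrE scalerAl.
Qed.

Section Key.
Variables I I' C D : set A.
Hypothesis I_hopf : is_hopf_ideal H I.
Hypothesis I'_hopf : is_hopf_ideal H I'.
Hypothesis I'I : I' `<=` I.
Hypothesis C_alg : is_subalgebra C.
Hypothesis C_coalg : forall c, C c -> pure_sums (C `*` C) (Delta c).
Hypothesis D_sub : subspace D.
Hypothesis D_coalg : forall d, D d -> pure_sums (D `*` D) (Delta d).
Hypothesis IC : I `&` C `<=` I'.
Hypothesis ID_gen :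
  I `&` D `<=` ideal_span (I' `|` [set c | C c /\ eps c = 0]).

Let I_id : is_ideal I. Proof. by case: I_hopf. Qed.
Let I'_id : is_ideal I'. Proof. by case: I'_hopf. Qed.
Let I_sub := ideal_subspace I_id.
Let I'_sub := ideal_subspace I'_id.
Let I_eps a : I a -> eps a = 0. Proof. by case: I_hopf => _ _ + _; apply. Qed.
Let I_S a : I a -> I (S a). Proof. by case: I_hopf => _ _ _; apply. Qed.
Let I'_S a : I' a -> I' (S a). Proof. by case: I'_hopf => _ _ _; apply. Qed.
Let I_comul a : I a -> pure_sums (in_either I I) (Delta a).
Proof. by case: I_hopf => _ + _ _; apply. Qed.
Let I'_comul a : I' a -> pure_sums (in_either I' I') (Delta a).
Proof. by case: I'_hopf => _ + _ _; apply. Qed.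
Let C_sub := subalgebra_subspace C_alg.
Let T_id : is_ideal (pure_sums (in_either I I')). Proof. exact: ideal_pure_sums. Qed.

Let I_n1 : ~ I 1.
Proof. by move=> /I_eps/eqP; rewrite rmorph1 oner_eq0. Qed.

Definition transfer_term (p : A * A * A) : tensor A A :=
  tens (p.1.1 * p.1.2) p.2 - tens p.1.1 (p.1.2 * p.2).

(** The kernel of the map from [A (x) A] to the tensor product of [A/I] and
    [A/I'] over [C]. Keeping an explicit list of exchanges of an element of
    [C] between the factors is what later provides a matrix of relations. *)
Definition balanced_zero : set (tensor A A) :=
  [set z | exists2 u : seq (A * A * A), {in u, forall p, C p.1.2}
         & pure_sums (in_either I I') (z - \sum_(p <- u) transfer_term p)].

Lemma ideal_balanced_zero : is_ideal balanced_zero.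
Proof.
have [T0 TD TM] := T_id.
have LD x y : balanced_zero x -> balanced_zero y -> balanced_zero (x + y).
  move=> [u Cu Tu] [v Cv Tv]; exists (u ++ v).
    by move=> p; rewrite mem_cat => /orP[/Cu|/Cv].
  by rewrite big_cat opprD addrACA; exact: TD.
have L0 : balanced_zero 0 by exists [::]; rewrite // big_nil subrr.
split=> // x y Ly; apply: (pure_sums_ind (f := *%R^~ y) (P := setT)) (pure_sumsT x) => //.
  by move=> a b; rewrite mulrDl.
move=> r s _; case: Ly => u Cu Tu.
exists [seq ((r * p.1.1, p.1.2), s * p.2) | p <- u].
  by move=> _ /mapP[p /Cu Cp ->].
rewrite big_map; under eq_bigr => p _.
  rewrite /transfer_term /= -[r * _ * _]mulrA [p.1.2 * (s * _)]mulrCA -!tensM -mulrBr.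
  rewrite -/(transfer_term p); over.
by rewrite -mulr_sumr -mulrBr; exact: TM.
Qed.

Lemma balanced_zero_either z : pure_sums (in_either I I') z -> balanced_zero z.
Proof. by exists [::] => //; rewrite big_nil subr0. Qed.

(** For [c] in [C], exchanging [c_2] turns [S(c_1) (x) c_2] into
    [S(c_1) c_2 (x) 1], which is the counit of [c]. The rest follows as
    [a |-> S(a_1) (x) a_2] is an algebra morphism. *)
Lemma balanced_zero_antipode_comul f :
  ideal_span (I' `|` [set c | C c /\ eps c = 0]) f -> balanced_zero (antipode_comul_l H f).
Proof.
have [L0 LD LM] := ideal_balanced_zero.
have antl0 : antipode_comul_l H 0 = 0 by apply: (@addrI _ (antipode_comul_l H 0)); rewrite -antipode_comul_lD !addr0.
move/(_ [set g | balanced_zero (antipode_comul_l H g)]); apply.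
split=> [|a [/I'_comul I'a|[Ca a0]]].
- split=> [|x y Lx Ly|x y Ly]; first by change (balanced_zero (antipode_comul_l H 0)); rewrite antl0.
    by change (balanced_zero (antipode_comul_l H (x + y))); rewrite antipode_comul_lD; exact: LD.
  by change (balanced_zero (antipode_comul_l H (x * y))); rewrite antipode_comul_lM; exact: LM.
- apply: balanced_zero_either; rewrite /antipode_comul_l /=.
  apply: (pure_sums_ind (tens_mapD _ _)) I'a; [exact: pure_sums0|exact: pure_sumsD|].
  move=> r s I'rs; rewrite tens_mapE; apply: pure_sums_tens.
  by case: I'rs => /= [/I'I/I_S|]; [left|right].
- change (balanced_zero (antipode_comul_l H a)); have [u Cu Da] := C_coalg Ca.
  exists [seq ((- S p.1, p.2), 1) | p <- u]; first by move=> _ /mapP[p /Cu[_ Cp] ->].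
  suff -> : antipode_comul_l H a = \sum_(p <- [seq ((- S p.1, p.2), 1) | p <- u]) transfer_term p.
    by rewrite subrr; exact: pure_sums0.
  rewrite big_map /transfer_term /= sumrB.
  have -> : \sum_(p <- u) tens (- S p.1 * p.2) 1 = 0 :> tensor A A.
    rewrite -(morph_sum _ _ _ (tensDl 1)) -[RHS](@tens0l k A A 1); congr tens.
    under eq_bigr do rewrite mulNr.
    rewrite sumrN; apply/eqP; rewrite oppr_eq0; apply/eqP.
    transitivity ((eps a)%:A : A); last by rewrite a0 scale0r.
    rewrite -(antipodel H) Da (morph_sum _ _ _ (tens_mapD _ _)).
    by rewrite (morph_sum _ _ _ tens_mulD); apply: eq_bigr => p _; rewrite tens_mapE tens_mulE.
  rewrite sub0r /antipode_comul_l /= Da (morph_sum _ _ _ (tens_mapD _ _)) -sumrN.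
  by apply: eq_bigr => p _; rewrite tens_mapE mulr1 -[- S _]scaleN1r tensZl scaleN1r opprK.
Qed.

(** Apply [a (x) b |-> a S(b_1) (x) b_2] to [Delta f]: it sends [I (x) A] into
    itself, and the right factors that lie in both [I] and [D] are covered by
    the hypothesis on [D]. *)
Lemma balanced_zero_tens1 f : I f -> D f -> balanced_zero (tens 1 f).
Proof.
move=> If Df; have [L0 LD LM] := ideal_balanced_zero; rewrite -(shear_l_comul H).
have := pure_sums_restrict D_sub D_sub I_sub (D_coalg Df) (I_comul If).
apply: (pure_sums_ind (shear_lD H)) => // r s [[/= _ Ds] Irs].
rewrite shear_lE; case: Irs => /= [Ir|Is].
  rewrite mulrC; apply: LM; apply: balanced_zero_either.
  by apply: pure_sums_tens; left.
by apply: LM; apply: balanced_zero_antipode_comul; exact: ID_gen.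
Qed.

Definition coef (l : {scalar A}) (p : A * A * A) : A :=
  (l (p.1.1 * p.1.2))%:A - l p.1.1 *: p.1.2.

Lemma tens_forml_transfer (l : {scalar A}) p :
  tens_forml l (transfer_term p) = coef l p * p.2.
Proof. by rewrite /transfer_term linearB /= !tens_formlE /coef mulrBl mulr_algl scalerAl. Qed.

Lemma ideal_coef_sum (l : {scalar A}) f (u : seq (A * A * A)) :
    (forall a, I a -> l a = 0) ->
    pure_sums (in_either I I') (tens 1 f - \sum_(p <- u) transfer_term p) ->
  I' (l 1 *: f - \sum_(p <- u) coef l p * p.2).
Proof.
move=> lI /(tens_forml_either I'_sub lI); congr I'.
have /= -> := linearB (tens_forml l) (tens 1 f) (\sum_(p <- u) transfer_term p).
rewrite tens_formlE (morph_sum _ _ _ (tens_formlD l)); congr (_ - _).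
by apply: eq_bigr => p _; exact: tens_forml_transfer.
Qed.

Lemma coef_in_subring (l : {scalar A}) p : C p.1.2 -> C (coef l p).
Proof.
have [C1 _ _] := C_alg.
by move=> Cp; apply: subspaceB => //; exact: subspaceZ.
Qed.

(** Contracting the left factor by forms that kill [I] turns the vanishing of
    [1 (x) F i] over [C] into linear relations with coefficients in [C], to
    which [mccoy_relation] applies. A single [mu] serves the whole family
    because the relations of all [F i] are the columns of one matrix. *)
Lemma torsion_family m (F : 'I_m -> A) : (forall i, balanced_zero (tens 1 (F i))) ->
  exists mu, [/\ C mu, ~ I mu & forall i, I' (mu * F i)].
Proof.
move=> LF; have [I'0 I'D I'M] := I'_id; have [I0 ID IM] := I_id.
have [i|u uP] := @choice _ _ (fun i (u : seq (A * A * A)) =>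
    {in u, forall p, C p.1.2} /\
    pure_sums (in_either I I') (tens 1 (F i) - \sum_(p <- u) transfer_term p)).
  by have [u ? ?] := LF i; exists u.
pose us := flatten [seq u i | i <- enum 'I_m].
have u_us i p : p \in u i -> p \in us.
  by move=> pu; apply/flatten_mapP; exists i; rewrite ?mem_enum.
have C_us p : p \in us -> C p.1.2.
  by case/flatten_mapP=> i _; have [+ _] := uP i; apply.
have [lam0 lam01 lam0I] := ex_scalar_vanishing I_sub I_n1.
(* Forms that kill M = I + k 1 leave room for a separate form kap with value
   1 at 1; together they read off coordinates with respect to 1 and the w i. *)
pose M := [set x : A | exists c : k, I (x - c%:A)].
have M_sub : subspace M.
  split=> [|a x y [c Ic] [d Id]]; first by exists 0; rewrite scale0r subrr.
  exists (a * c + d); suff -> : a *: x + y - (a * c + d)%:A = a *: (x - c%:A) + (y - d%:A).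
    exact: I_sub.2.
  by rewrite scalerDl scalerBr scalerA opprD addrACA.
have setT_sub : subspace [set: A] by [].
pose xs := [seq p.1.1 | p <- us] ++ [seq p.1.1 * p.1.2 | p <- us].
have [//|n [w [l [_ lM _ xsM]]]] := @dual_system _ _ M setT xs M_sub setT_sub.
have IM0 x : I x -> M x by exists 0; rewrite scale0r subr0.
pose r x := x - \sum_i l i x *: w i.
have r_lin : linear r.
  move=> c x y; rewrite /r scalerBr scaler_sumr addrACA -opprD -big_split.
  by congr (_ - _); apply: eq_bigr => i _; rewrite linearP scalerDl scalerA.
have [|kap kapE] := @scalar_pack k A (lam0 \o r).
  by move=> c x y; rewrite /= r_lin linearP.
have kapI x : I x -> kap x = 0.
  move=> Ix; rewrite kapE /= /r big1 ?subr0 ?lam0I // => i _.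
  by rewrite lM ?scale0r //; exact: IM0.
have kap1 : kap 1 = 1.
  rewrite kapE /= /r big1 ?subr0 // => i _; rewrite lM ?scale0r //.
  by exists 1; rewrite scale1r subrr.
have xsI x : x \in xs -> I ((kap x)%:A + \sum_i l i x *: w i - x).
  move=> /xsM[c Ic]; suff -> : kap x = c.
    by have := subspaceN I_sub Ic; rewrite !opprB addrA.
    have := lam0I _ Ic; rewrite linearB linearZ /= lam01 mulr1 -/(r x).
  by rewrite kapE /= => /eqP; rewrite subr_eq0 => /eqP.
pose col (t : 'I_(size us)) := tnth (in_tuple us) t.
have col_us t : col t \in us by exact: mem_tnth.
have [| |t|mu [nu [Cmu nImu Cnu rel]]] :=
  @mccoy_relation A I C n (size us) w (coef kap \o col) (fun i => coef (l i) \o col) I_id I_n1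
    (subalgebra_subring C_alg).
- by move=> t; apply/coef_in_subring/C_us.
- by move=> i t; apply/coef_in_subring/C_us.
- rewrite /=; have := col_us t; case: (col t) => -[x d] y /= pus.
  have Ix : I ((kap x)%:A + \sum_i l i x *: w i - x).
    by apply: xsI; rewrite mem_cat (map_f (fun p : A * A * A => p.1.1) pus).
  have Ixd : I ((kap (x * d))%:A + \sum_i l i (x * d) *: w i - x * d).
    by apply: xsI; rewrite mem_cat (map_f (fun p : A * A * A => p.1.1 * p.1.2) pus) orbT.
  have := idealB I_id Ixd (IM d _ Ix); congr I.
  rewrite mulrBr mulrDr opprB [d * x]mulrC addrA addrNK opprD addrACA /coef /=.
  rewrite mulr_algr; congr (_ + _); rewrite mulr_sumr -sumrB; apply: eq_bigr => i _.
  by rewrite mulrBr mulr_algr -!scalerAr [w i * d]mulrC.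
exists mu; split=> // i.
have {}rel p : p \in us -> I' (mu * coef kap p - \sum_j nu j * coef (l j) p).
  move=> pus; apply: IC; split.
    by have /seq_tnthP[t ->] := pus; exact: rel.
  have C_ring := subalgebra_subring C_alg.
  apply: subspaceB => //; first by apply: subringM => //; apply/coef_in_subring/C_us.
  by apply: subspace_sum => // j _; apply: subringM => //; apply/coef_in_subring/C_us.
have Fl j : I' (\sum_(p <- u i) coef (l j) p * p.2).
  have lI x : I x -> l j x = 0 by move=> /IM0/lM.
  have := ideal_coef_sum lI (uP i).2.
  rewrite lM ?scale0r ?sub0r => [/(subspaceN I'_sub)|]; first by rewrite opprK.
  by exists 1; rewrite scale1r subrr.
have := ideal_coef_sum kapI (uP i).2; rewrite kap1 scale1r => /(I'M mu) I'_kap.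
have I'_rel : I' (\sum_(p <- u i) (mu * coef kap p - \sum_j nu j * coef (l j) p) * p.2).
  by apply: subspace_sum_seq => // p /u_us/rel Ip; rewrite mulrC; exact: I'M.
have I'_l : I' (\sum_j nu j * \sum_(p <- u i) coef (l j) p * p.2).
  by apply: ideal_sum => // j; exact: I'M.
have E : \sum_(p <- u i) (mu * coef kap p - \sum_j nu j * coef (l j) p) * p.2 =
    mu * (\sum_(p <- u i) coef kap p * p.2) -
    \sum_j nu j * \sum_(p <- u i) coef (l j) p * p.2.
  under eq_bigr do rewrite mulrBl mulr_suml.
  rewrite sumrB exchange_big mulr_sumr; congr (_ - _).
    by apply: eq_bigr => p _; rewrite mulrA.
  by apply: eq_bigr => j _; rewrite mulr_sumr; apply: eq_bigr => p _; rewrite mulrA.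
have := I'D _ _ (I'D _ _ I'_kap I'_rel) I'_l; congr I'.
by rewrite E mulrBr addrA addrNK addrNK.
Qed.

(** The annihilator of the family [F] modulo [I'] is stable under the right
    coaction modulo [I]. Indeed [c_1 F (x) c_2] equals
    [c_1 F_1 (x) c_2 F_2 S(F_3)], which is the image of [c F_1 (x) F_2] under
    the second shear map; that map preserves [I' (x) A + A (x) I]. *)
Lemma annihilator_rcontract m (F : 'I_m -> A) c (l : {scalar A}) :
    (forall j, pure_sums [set p | (exists i, p.1 = F i) \/ I p.2] (Delta (F j))) ->
    (forall j, I' (c * F j)) -> (forall a, I a -> l a = 0) ->
  forall j, I' (rcontract H l c * F j).
Proof.
move=> F_coalg cF lI j; rewrite -tens_formr_mulr.
apply: (tens_formr_either (J := I) I'_sub lI); rewrite -(shear_r_comul H) -shear_r_mull.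
have [T0 TD TM] : is_ideal (pure_sums (in_either I' I)) by exact: ideal_pure_sums.
suff: pure_sums (in_either I' I) (tens c 1 * Delta (F j)).
  apply: (pure_sums_ind (shear_rD H)) => // r s I'rs; rewrite shear_rE.
  case: I'rs => /= [I'r|Is].
    rewrite mulrC; apply: TM; apply: sub_pure_sums (I'_comul I'r).
    by move=> p [|/I'I]; [left|right].
  by apply: TM; apply: pure_sums_tens; right; exact: I_S.
move: (F_coalg j); apply: (pure_sums_ind (f := *%R (tens c 1))) => [x y|//||r s Frs].
- exact: mulrDr.
- exact: TD.
rewrite tensM mul1r; apply: pure_sums_tens.
by case: Frs => /= [[i ->]|Is]; [left; exact: cF|right].
Qed.

(** Two nested subgroups with the same image at the level of [C] and the same
    kernel agree at the level of [D]. The elements [F i] are the left factors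
    of [Delta f]; their common annihilator modulo [I'] meets [C] outside [I],
    hence contains an element of [C] of counit 1, hence contains 1. *)
Lemma hopf_ideals_agree : I `&` D `<=` I'.
Proof.
move=> f [If Df]; have [I'0 I'D I'M] := I'_id.
have [m [w [l [_ lI _ [z Dz Df_eq]]]]] := tensor_dual_system I_sub D_sub (D_coalg Df).
pose F i := rcontract H (l i) f.
have IF i : I (F i) by apply: (tens_formr_either I_sub (lI i)); exact: I_comul.
have DF i : D (F i) by apply: tens_formr_setX (D_coalg Df).
have F_coalg j : pure_sums [set p | (exists i, p.1 = F i) \/ I p.2] (Delta (F j)).
  rewrite comul_rcontract Df_eq tens_mapD; apply: pure_sumsD.
    rewrite (morph_sum _ _ _ (tens_mapD _ _)); apply: pure_sums_ord => i.
    by rewrite tens_mapE; apply: pure_sums_tens; left; exists i.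
  apply: (pure_sums_ind (tens_mapD _ _)) Dz; [exact: pure_sums0|exact: pure_sumsD|].
  move=> r s [/= _ [_ Is]]; rewrite tens_mapE; apply: pure_sums_tens; right => /=.
  by apply: (tens_formr_either I_sub (lI j)); exact: I_comul.
suff I'F i : I' (F i).
  rewrite -(counitr H f) Df_eq linearD linear_sum /=; apply: (I'D).
    by apply: subspace_sum => // i _; rewrite tens_formrE; exact: (subspaceZ I'_sub _ (I'F i)).
  apply: (pure_sums_ind (tens_formrD _)) Dz => [||r s [/= _ [_ Is]]].
  - exact: I'0.
  - exact: I'D.
  by rewrite tens_formrE /= I_eps // scale0r; exact: I'0.
have [mu [Cmu nImu mu_F]] := torsion_family (fun i => balanced_zero_tens1 (IF i) (DF i)).
(* Modulo I, mu is a combination of the v j with the counits of its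
   contractions as coefficients, so these do not all vanish. *)
have [p [Cp p_eps p_F]] : exists p, [/\ C p, eps p = 1 & forall j, I' (p * F j)].
  have [n [v [q [_ qI _ [y Cy Dmu]]]]] := tensor_dual_system I_sub C_sub (C_coalg Cmu).
  have [j ej] : exists j, eps (rcontract H (q j) mu) != 0.
    apply: contrapT => nex; apply: nImu.
    rewrite -(counitl H mu) Dmu linearD linear_sum /=; apply: subspaceD => //.
      apply: subspace_sum => // j _; rewrite tens_formlE.
      have [/= ->|ne] := eqVneq (eps (rcontract H (q j) mu)) 0.
        by rewrite scale0r; exact: subspace0.
      by case: nex; exists j.
    apply: (pure_sums_ind (tens_formlD _)) Cy => [|a b|r s [/= _ [_ Is]]].
    + exact: subspace0.
    + exact: subspaceD.
    + by rewrite tens_formlE; exact: subspaceZ.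
  exists ((eps (rcontract H (q j) mu))^-1 *: rcontract H (q j) mu); split.
  - by apply: subspaceZ => //; exact: tens_formr_setX (C_coalg Cmu).
  - by rewrite linearZ /= mulVf.
  - move=> i'; rewrite -scalerAl; apply: subspaceZ => //.
    exact: (annihilator_rcontract F_coalg mu_F (qI j)).
(* Now 1 = p_1 S(p_2), where p_1 may be taken to be a contraction of p, up to
   terms with p_2 in I and C, hence in I'. *)
have [n [v [q [Cv qI _ [y Cy Dp]]]]] := tensor_dual_system I_sub C_sub (C_coalg Cp).
rewrite -[F i]mul1r -(scale1r 1) -p_eps -(antipoder H) Dp tens_mapD tens_mulD mulrDl.
apply: (I'D).
  rewrite (morph_sum _ _ _ (tens_mapD _ _)) (morph_sum _ _ _ tens_mulD) mulr_suml.
  apply: ideal_sum => // j; rewrite tens_mapE tens_mulE /= mulrAC mulrC; apply: (I'M).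
  exact: (annihilator_rcontract F_coalg p_F (qI j)).
rewrite mulrC; apply: (I'M); move: Cy.
have mulD : {morph (@tens_mul k A) \o tens_map idfun S : a b / a + b}.
  by move=> a b; rewrite /= tens_mapD tens_mulD.
apply: (pure_sums_ind mulD) => [||r s [/= _ [Cs Is]]].
- exact: I'0.
- exact: I'D.
by rewrite tens_mapE tens_mulE; apply/I'M/I'_S/IC.
Qed.

End Key.
End Comparison.

(** * Leading monomials of a difference ideal *)

Section SigmaMonomials.
Variable n : nat.
Implicit Types m : 'I_n -> nat.

Section OneRing.
Context {R : comPzRingType}.
Variable sR : sigma_ring n R.

Lemma sigma_mon_ind (P : R -> Prop) m x :
  (forall j y, P y -> P (sR j y)) -> P x -> P (sigma_mon sR m x).
Proof.
rewrite /sigma_mon => sP Px; elim: (enum 'I_n) => //= j s IH.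
by elim: (m j) => //= r; exact: sP.
Qed.

Lemma sigma_mon_is_nmod_morphism m : nmod_morphism (sigma_mon sR m).
Proof.
rewrite /sigma_mon; elim: (enum 'I_n) => //= j s [IH0 IHD].
by elim: (m j) => //= r [r0 rD]; split=> [|x y]; rewrite ?r0 ?rmorph0 // rD rmorphD.
Qed.

Lemma sigma_mon_is_monoid_morphism m : monoid_morphism (sigma_mon sR m).
Proof.
rewrite /sigma_mon; elim: (enum 'I_n) => //= j s [IH1 IHM].
by elim: (m j) => //= r [r1 rM]; split=> [|x y]; rewrite ?r1 ?rmorph1 // rM rmorphM.
Qed.

HB.instance Definition _ m :=
  GRing.isNmodMorphism.Build R R (sigma_mon sR m) (sigma_mon_is_nmod_morphism m).
HB.instance Definition _ m :=
  GRing.isMonoidMorphism.Build R R (sigma_mon sR m) (sigma_mon_is_monoid_morphism m).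

Lemma sigma_mon_eq m m' x : m =1 m' -> sigma_mon sR m x = sigma_mon sR m' x.
Proof. by move=> mm'; rewrite /sigma_mon; elim: (enum 'I_n) => //= j s ->; rewrite mm'. Qed.

Lemma sigma_mon_add (a b : {ffun 'I_n -> nat}) x :
  sigma_mon sR (expo_add a b) x = sigma_mon sR a (sigma_mon sR b x).
Proof.
rewrite [sigma_mon sR (expo_add a b) x]/sigma_mon [sigma_mon sR b x]/sigma_mon.
rewrite /sigma_mon.
suff E (s : seq 'I_n) y : foldr (fun j => iter (expo_add a b j) (sR j)) y s =
  foldr (fun j => iter (a j) (sR j)) (foldr (fun j => iter (b j) (sR j)) y s) s by exact: E.
elim: s => //= j s ->; rewrite ffunE iterD; congr (iter _ _ _).
elim: (b j) => //= r ->; move: (foldr _ y s) => {y} y; move: (iter r _ y) => {y} y.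
elim: s => //= i s <-; elim: (a i) => //= q <-.
by rewrite sigma_comm.
Qed.

End OneRing.

Lemma sigma_mon_morph (R S : comPzRingType) (sR : sigma_ring n R) (sS : sigma_ring n S)
    (f : R -> S) m x : sigma_morph sR sS f ->
  f (sigma_mon sR m x) = sigma_mon sS m (f x).
Proof.
rewrite /sigma_mon => fs; elim: (enum 'I_n) => //= j s <-.
by elim: (m j) => //= r <-; rewrite fs.
Qed.

Lemma sigma_monZ (k : fieldType) (sk : sigma_ring n k) (A : comAlgType k)
    (sA : sigma_algebra sk A) m (c : k) (x : A) :
  sigma_mon sA m (c *: x) = sigma_mon sk m c *: sigma_mon sA m x.
Proof.
rewrite -mulr_algl rmorphM -[RHS]mulr_algl; congr (_ * _).
by have /= := sigma_mon_morph m c (sigma_in_alg sA).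
Qed.

Lemma sigma_mon_tens (k : fieldType) (sk : sigma_ring n k) (A : comAlgType k)
    (sA : sigma_algebra sk A) m (x y : A) :
  sigma_mon (tens_sigma_algebra sA sA) m (tens x y) =
  tens (sigma_mon sA m x) (sigma_mon sA m y).
Proof.
rewrite /sigma_mon; elim: (enum 'I_n) => //= j s ->.
by elim: (m j) => //= r ->; rewrite tens_sigmaE.
Qed.

Lemma sigma_ideal_mon (R : comPzRingType) (sR : sigma_ring n R) (I : set R) m x :
  is_sigma_ideal sR I -> I x -> I (sigma_mon sR m x).
Proof. by case=> _ I_sigma Ix; apply: sigma_mon_ind. Qed.

End SigmaMonomials.

Lemma dickson_pairs (I J : finType) (X : set ({ffun I -> nat} * {ffun J -> nat})) :
  exists2 s : seq ({ffun I -> nat} * {ffun J -> nat}), {in s, forall p, X p} &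
  forall p, X p -> exists2 q, q \in s &
    exists r c, p = (expo_add r q.1, expo_add c q.2).
Proof.
pose enc (p : {ffun I -> nat} * {ffun J -> nat}) : {ffun I + J -> nat} :=
  [ffun e => match e with inl i => p.1 i | inr j => p.2 j end].
pose dec (f : {ffun I + J -> nat}) : {ffun I -> nat} * {ffun J -> nat} :=
  ([ffun i => f (inl i)], [ffun j => f (inr j)]).
have decK : cancel enc dec.
  by case=> a b; congr pair; apply/ffunP => i; rewrite !ffunE.
have [s sX Xs] := dickson [set f | X (dec f)].
exists [seq dec f | f <- s] => [_ /mapP[f /sX Xf ->] //|[a b] Xp].
have [|f fs le_f] := Xs (enc (a, b)); first by rewrite /= decK.
exists (dec f); first exact: map_f.
exists [ffun i => (a i - f (inl i))%N], [ffun j => (b j - f (inr j))%N].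
congr pair; apply/ffunP => i; rewrite !ffunE subnK //.
  by have := le_f (inl i); rewrite ffunE.
by have := le_f (inr i); rewrite ffunE.
Qed.

Section SigmaHopf.
Context {n : nat} {k : fieldType} {sk : sigma_ring n k} {A : comAlgType k}.
Variable H : sigma_hopf_algebra sk A.
Local Notation Delta := (comul H).
Local Notation eps := (counit H).
Local Notation S := (antipode H).
Local Notation mon := (sigma_mon H).
Local Notation expo := {ffun 'I_n -> nat}.
Implicit Types (t r : expo) (P Q : set expo) (K : set A).

Variables (m : nat) (X : 'I_m -> A).
Hypothesis X_coalg : forall i,
  pure_sums ([set x | exists j, x = X j] `*` [set x | exists j, x = X j]) (Delta (X i)).

(** For an initial segment [P] of exponents, the coordinate algebra of a
    projection of the group. *)
Definition sigma_subalg P : set A :=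
  smallest (@is_subalgebra k A) [set y | exists t i, P t /\ y = mon t (X i)].

Lemma sigma_subalg_subalgebra P : is_subalgebra (sigma_subalg P).
Proof.
split=> [B [[B1 _ _]]//|c x y Bx By B BP|x y Bx By B BP].
  by case: (BP) => -[_ + _] _; apply; [exact: Bx|exact: By].
by case: (BP) => -[_ _ +] _; apply; [exact: Bx|exact: By].
Qed.

Lemma sigma_subalg_gen P t i : P t -> sigma_subalg P (mon t (X i)).
Proof. by move=> Pt B [_]; apply; exists t, i. Qed.

Lemma sigma_subalg_ind P (B : set A) : is_subalgebra B ->
  (forall t i, P t -> B (mon t (X i))) -> sigma_subalg P `<=` B.
Proof. by move=> B_alg BX x /(_ B); apply; split=> // _ [t [i [Pt ->]]]; exact: BX. Qed.

Lemma sub_sigma_subalg P Q : P `<=` Q -> sigma_subalg P `<=` sigma_subalg Q.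
Proof.
by move=> PQ; apply: sigma_subalg_ind => [|t i Pt]; [exact: sigma_subalg_subalgebra|apply: sigma_subalg_gen; exact: PQ].
Qed.

Lemma sigma_subalg_comul P a : sigma_subalg P a -> pure_sums (sigma_subalg P `*` sigma_subalg P) (Delta a).
Proof.
have PA := sigma_subalg_subalgebra P; have [P1 Pl PM] := PA.
have P_sub := subalgebra_subspace PA.
move: a; apply: (@sigma_subalg_ind P [set a | pure_sums (sigma_subalg P `*` sigma_subalg P) (Delta a)]) => [|t i Pt].
  split=> [|c x y Px Py|x y Px Py] /=.
  - by rewrite rmorph1 -tens11; apply: pure_sums_tens.
  - rewrite linearP; apply: pure_sumsD => //.
    apply: (pure_sums_ind (f := fun x => c *: x)) Px => [u v|||u v [/= Pu Pv]].
    + exact: scalerDr.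
    + exact: pure_sums0.
    + exact: pure_sumsD.
    + by rewrite -tensZl; apply: pure_sums_tens; split=> //; exact: (subspaceZ P_sub c Pu).
  - rewrite rmorphM; apply: pure_sumsM Px Py => p q [Pp1 Pp2] [Pq1 Pq2].
    by split; exact: PM.
rewrite /= (sigma_mon_morph _ _ (sigma_comul H)).
apply: (pure_sums_ind (f := sigma_mon (tens_sigma_algebra H H) t)) (X_coalg i) => [u v|||u v [/= [j ->] [l ->]]].
- exact: rmorphD.
- exact: pure_sums0.
- exact: pure_sumsD.
- by rewrite sigma_mon_tens; apply: pure_sums_tens; split; exact: sigma_subalg_gen.
Qed.

Lemma sigma_subalg_shift P Q r : (forall t, P t -> Q (expo_add r t)) ->
  forall a, sigma_subalg P a -> sigma_subalg Q (mon r a).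
Proof.
move=> PQ; apply: (@sigma_subalg_ind P [set a | sigma_subalg Q (mon r a)]) => [|t i Pt]; last first.
  by rewrite /= -sigma_mon_add; apply: sigma_subalg_gen; exact: PQ.
have [Q1 Ql QM] := sigma_subalg_subalgebra Q; split=> [|c x y Qx Qy|x y Qx Qy] /=.
- by rewrite rmorph1.
- by rewrite rmorphD /= sigma_monZ; exact: Ql.
- by rewrite rmorphM; exact: QM.
Qed.

Definition below t : set expo := [set t' | lexlt t' t].
Definition upto t : set expo := [set t' | t' = t \/ lexlt t' t].

Lemma sub_upto t t' : lexlt t t' -> upto t `<=` upto t'.
Proof. by move=> tt' r [->|rt]; right => //; exact: lexlt_trans tt'. Qed.

(** Initial segments are nested, so the finitely many exponents involved in a
    non-constant element have a largest one, which alone matters. *)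
Lemma sigma_subalg_upto P a : sigma_subalg P a ->
  (exists c : k, a = c%:A) \/ (exists2 t, P t & sigma_subalg (upto t) a).
Proof.
have up t := sigma_subalg_subalgebra (upto t).
have upc t (c : k) : sigma_subalg (upto t) c%:A.
  by apply: (subspaceZ (subalgebra_subspace (up t))); case: (up t).
have join x y : ((exists c : k, x = c%:A) \/ (exists2 t, P t & sigma_subalg (upto t) x)) ->
    ((exists c : k, y = c%:A) \/ (exists2 t, P t & sigma_subalg (upto t) y)) ->
    (exists c d : k, x = c%:A /\ y = d%:A) \/
    (exists2 t, P t & sigma_subalg (upto t) x /\ sigma_subalg (upto t) y).
  case=> [[c ->]|[t Pt tx]] [[d ->]|[t' Pt' ty]]; first by left; exists c, d.
  - by right; exists t'.
  - by right; exists t.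
  - right; case: (lexlt_total t t') => [tt'|tt'|tt'].
    + by exists t' => //; split=> //; apply: sub_sigma_subalg tx; exact: sub_upto.
    + by exists t => //; split=> //; rewrite tt'.
    + by exists t => //; split=> //; apply: sub_sigma_subalg ty; exact: sub_upto.
move: a; apply: (@sigma_subalg_ind P [set a | (exists c : k, a = c%:A) \/
  (exists2 t, P t & sigma_subalg (upto t) a)]) => [|t i Pt]; last by right; exists t => //; apply: sigma_subalg_gen; left.
split=> [|c x y Bx By|x y Bx By]; first by left; exists 1; rewrite scale1r.
- case: (join _ _ Bx By) => [[a1 [a2 [-> ->]]]|[t Pt [tx ty]]].
    by left; exists (c * a1 + a2); rewrite scalerDl scalerA.
  by right; exists t => //; case: (up t) => _ + _; exact.
- case: (join _ _ Bx By) => [[a1 [a2 [-> ->]]]|[t Pt [tx ty]]].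
    by left; exists (a1 * a2); rewrite -scalerAl mul1r scalerA.
  by right; exists t => //; case: (up t) => _ _; exact.
Qed.

Definition monomial t (al : {ffun 'I_m -> nat}) : A := \prod_i mon t (X i) ^+ al i.

Lemma monomial_add t al be : monomial t (expo_add al be) = monomial t al * monomial t be.
Proof. by rewrite /monomial -big_split; apply: eq_bigr => i _; rewrite ffunE exprD. Qed.

Lemma monomial0 t : monomial t [ffun=> 0%N] = 1.
Proof. by rewrite /monomial big1 // => i _; rewrite ffunE expr0. Qed.

Lemma monomial_gen t i : monomial t [ffun j => (j == i) : nat] = mon t (X i).
Proof.
rewrite /monomial (bigD1 i) //= ffunE eqxx expr1 big1 ?mulr1 // => j /negPf ji.
by rewrite ffunE ji expr0.
Qed.

Lemma mon_monomial r t al : mon r (monomial t al) = monomial (expo_add r t) al.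
Proof.
rewrite /monomial rmorph_prod; apply: eq_bigr => i _.
by rewrite rmorphXn /= sigma_mon_add.
Qed.

Definition polys t (P : set {ffun 'I_m -> nat}) : set A :=
  smallest subspace [set y | exists2 al, P al & y = monomial t al].

Lemma polys_subspace t (P : set {ffun 'I_m -> nat}) : subspace (polys t P).
Proof.
split=> [B [B_sub _]|c x y Bx By B BP]; first exact: subspace0.
by case: (BP) => -[_ +] _; apply; [exact: Bx|exact: By].
Qed.

Lemma polys_monomial t (P : set {ffun 'I_m -> nat}) al : P al -> polys t P (monomial t al).
Proof. by move=> Pal B [_]; apply; exists al. Qed.

Lemma polys_ind t (P : set {ffun 'I_m -> nat}) (B : set A) : subspace B ->
  (forall al : {ffun 'I_m -> nat}, P al -> B (monomial t al)) -> polys t P `<=` B.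
Proof. by move=> B_sub BX x /(_ B); apply; split=> // _ [al Pal ->]; exact: BX. Qed.

Lemma sub_polys t (P Q : set {ffun 'I_m -> nat}) : P `<=` Q -> polys t P `<=` polys t Q.
Proof.
by move=> PQ; apply: polys_ind => [|al Pal]; [exact: polys_subspace|apply: polys_monomial; exact: PQ].
Qed.

Definition lower (al : {ffun 'I_m -> nat}) : set {ffun 'I_m -> nat} :=
  [set be | lexlt be al].

Lemma sub_lower al be : lexlt al be -> lower al `<=` lower be.
Proof. by move=> ab c ca; exact: lexlt_trans ab. Qed.

(** Values of polynomials are not uniquely written, so this is only a choice
    of a leading exponent; the coefficient [c] may vanish. *)
Lemma polys_leading t (P : set {ffun 'I_m -> nat}) z : polys t P z ->
  z = 0 \/ exists2 al, P al & exists c, polys t (lower al) (z - c *: monomial t al).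
Proof.
have lowP al := polys_subspace t (lower al).
move: z; apply: polys_ind => [|al Pal]; last first.
  by right; exists al => //; exists 1; rewrite scale1r subrr; exact: (subspace0 (lowP al)).
have top al be c d x : lexlt al be -> polys t (lower al) (x - c *: monomial t al) ->
    polys t (lower be) (d *: x).
  move=> lt_ab low; apply: (subspaceZ (lowP be)); rewrite -(subrK (c *: monomial t al) x).
  apply: (subspaceD (lowP be)); first by apply: sub_polys low; exact: sub_lower.
  by apply: (subspaceZ (lowP be)); exact: polys_monomial.
split=> [|c x y]; first by left.
case=> [->|[al Pal [a low_a]]]; first by rewrite scaler0 add0r.
case=> [->|[be Pbe [b low_b]]].
  rewrite addr0; right; exists al => //; exists (c * a).
  by rewrite -scalerA -scalerBr; exact: (subspaceZ (lowP al)).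
right; case: (lexlt_total al be) => [lt_ab|eq_ab|lt_ba].
- exists be => //; exists b; rewrite -addrA; apply: (subspaceD (lowP be)) => //.
  exact: top lt_ab low_a.
- exists be => //; exists (c * a + b); rewrite eq_ab in low_a.
  rewrite scalerDl -scalerA opprD addrACA -scalerBr.
  by apply: (subspaceD (lowP be)) => //; exact: (subspaceZ (lowP be)).
- exists al => //; exists (c * a); rewrite -scalerA addrAC -scalerBr.
  apply: (subspaceD (lowP al)); first exact: (subspaceZ (lowP al)).
  by rewrite -[y]scale1r; exact: top lt_ba low_b.
Qed.

Definition augmentation t : set A := [set c | sigma_subalg (below t) c /\ eps c = 0].

(** For a Hopf ideal [K], the ideal of the kernel of the projection from level
    [upto t] to level [below t] of the subgroup defined by [K]. *)
Definition modulo K t : set A := ideal_span (K `|` augmentation t).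

Lemma ideal_span_ideal (Y : set A) : is_ideal (ideal_span Y).
Proof.
split=> [B [[]]//|x y Bx By B BP|a x Bx B BP].
  by case: (BP) => -[_ + _] _; apply; [exact: Bx|exact: By].
by case: (BP) => -[_ _ +] _; apply; exact: Bx.
Qed.

Lemma ideal_span_gen (Y : set A) : Y `<=` ideal_span Y.
Proof. by move=> y Yy B [_]; exact. Qed.

Lemma ideal_span_ind (Y B : set A) : is_ideal B -> Y `<=` B -> ideal_span Y `<=` B.
Proof. by move=> B_id YB x /(_ B); exact. Qed.

Lemma modulo_shift K t r x : is_sigma_ideal H K ->
  modulo K t x -> modulo K (expo_add r t) (mon r x).
Proof.
move=> K_sigma; have [M0 MD MM] := ideal_span_ideal (K `|` augmentation (expo_add r t)).
move: x; apply: (@ideal_span_ind _ [set x | modulo K (expo_add r t) (mon r x)]).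
  split=> [|x y Mx My|a x Mx] /=; first by rewrite rmorph0.
    by rewrite rmorphD; exact: MD.
  by rewrite rmorphM; exact: MM.
move=> x [Kx|[Cx x0]]; apply: ideal_span_gen; first by left; exact: sigma_ideal_mon.
right; split; first by apply: sigma_subalg_shift Cx => t' /=; rewrite /below /= lexlt_addl.
by rewrite (sigma_mon_morph _ _ (sigma_counit H)) x0 rmorph0.
Qed.

(** Leading exponents of the polynomials in the [t(x_i)] that vanish on the
    kernel at level [t], defined by elements with leading coefficient 1. *)
Definition leading K t al : Prop :=
  exists2 z, polys t (lower al) z & modulo K t (monomial t al - z).

(** The endomorphism [mon r] sends the level [t] to the level [r + t] and is
    additive and semilinear, so it keeps a leading coefficient 1;
    multiplication by a monomial respects the order. *)
Lemma leading_shift K t al r ga : is_sigma_ideal H K ->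
  leading K t al -> leading K (expo_add r t) (expo_add ga al).
Proof.
move=> K_sigma [z low_z Kz]; set t' := expo_add r t.
exists (monomial t' ga * mon r z); last first.
  have [_ _ MM] := ideal_span_ideal (K `|` augmentation t').
  rewrite monomial_add -mulrBr -(mon_monomial r t al); apply: MM.
  have <- : mon r (monomial t al - z) = mon r (monomial t al) - mon r z by rewrite rmorphB.
  exact: modulo_shift.
have low_sub := polys_subspace t' (lower (expo_add ga al)).
move: z low_z {Kz}; apply: (@polys_ind _ _
  [set z | polys t' (lower (expo_add ga al)) (monomial t' ga * mon r z)]).
  split=> [|c x y Bx By] /=; first by rewrite rmorph0 mulr0; exact: (subspace0 low_sub).
  rewrite rmorphD /= sigma_monZ mulrDr -scalerAr.
  by apply: (subspaceD low_sub) => //; exact: (subspaceZ low_sub).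
move=> be lt_be /=; rewrite mon_monomial -monomial_add; apply: polys_monomial.
by rewrite /lower /= lexlt_addl.
Qed.

(** Membership in [modulo K t] involves only one element of [K], so the same
    exponent is leading for every ideal containing it. *)
Lemma leading_witness K t al : is_ideal K -> leading K t al ->
  exists2 g, K g & forall K', is_ideal K' -> K' g -> leading K' t al.
Proof.
move=> [K0 KD KM] [z low_z].
have : modulo K t `<=` [set x | exists2 g, K g & ideal_span (augmentation t) (x - g)].
  have [M0 MD MM] := ideal_span_ideal (augmentation t).
  apply: ideal_span_ind.
    split=> [|x y [g Kg xg] [h Kh yh]|a x [g Kg xg]] /=.
    - by exists 0; rewrite ?subrr.
    - by exists (g + h); [exact: KD|rewrite opprD addrACA; exact: MD].
    - by exists (a * g); [exact: KM|rewrite -mulrBr; exact: MM].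
  move=> x [Kx|Cx]; first by exists x; rewrite ?subrr.
  by exists 0; rewrite ?subr0 //; exact: ideal_span_gen.
move=> sub /sub[g Kg zg]; exists g => // K' K'_id K'g; exists z => //.
have [M0 MD MM] := ideal_span_ideal (K' `|` augmentation t).
rewrite -(subrK g (monomial t al - z)); apply: MD.
  apply: ideal_span_ind zg => [|x Cx]; first exact: ideal_span_ideal.
  by apply: ideal_span_gen; right.
by apply: ideal_span_gen; left.
Qed.

(** Division algorithm: an element whose leading exponent is leading for [K']
    can be lowered modulo [K'], and the lexicographic order is
    well-founded. *)
Lemma modulo_of_leading K K' t : is_ideal K -> is_ideal K' -> K' `<=` K ->
    (forall al, leading K t al -> leading K' t al) ->
  polys t setT `&` modulo K t `<=` modulo K' t.
Proof.
move=> K_id K'_id K'K lead.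
have M'_id := ideal_span_ideal (K' `|` augmentation t).
have M_id := ideal_span_ideal (K `|` augmentation t).
have [M'_sub M_sub] := (ideal_subspace M'_id, ideal_subspace M_id).
have M'M : modulo K' t `<=` modulo K t.
  apply: ideal_span_ind => // x [/K'K Kx|Cx]; apply: ideal_span_gen; by [left|right].
have red (P : set {ffun 'I_m -> nat}) z :
    (forall al : {ffun 'I_m -> nat}, P al -> polys t (lower al) `&` modulo K t `<=` modulo K' t) ->
    polys t P z -> modulo K t z -> modulo K' t z.
  move=> IH /polys_leading[-> _|[al Pal [c low_z]] Mz]; first exact: (subspace0 M'_sub).
  have low_sub := polys_subspace t (lower al).
  (* If c vanishes then z already has a smaller leading exponent; otherwise al is
     leading for K, hence for K', and z can be reduced. *)
  have [c0|c0] := eqVneq c 0.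
    by apply: (IH al) => //; split=> //; rewrite c0 scale0r subr0 in low_z.
  have [|y low_y My] := lead al.
    exists (- c^-1 *: (z - c *: monomial t al)); first exact: (subspaceZ low_sub).
    rewrite scalerBr scalerA mulNr mulVf // !scaleNr scale1r opprK opprD opprK.
    by rewrite addrCA subrr addr0; exact: (subspaceZ M_sub).
  rewrite -(subrK (c *: (monomial t al - y)) z).
  apply: (subspaceD M'_sub); last exact: (subspaceZ M'_sub).
  apply: (IH al) => //; split; last first.
    by apply: (subspaceB M_sub) => //; apply: (subspaceZ M_sub); exact: M'M.
  rewrite scalerBr opprB addrCA; apply: (subspaceD low_sub) => //.
  exact: (subspaceZ low_sub).
suff low al : polys t (lower al) `&` modulo K t `<=` modulo K' t.
  by move=> z [Pz Mz]; apply: red Pz Mz => al _; exact: low.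
apply: contrapT => nlow.
have [|be nbe min_be] := @lexlt_min _ [set al | ~ (polys t (lower al) `&` modulo K t `<=` modulo K' t)].
  by exists al.
apply: nbe => z [low_z Mz]; apply: red low_z Mz => ga lt_ga.
by apply: contrapT => /min_be/negP; apply.
Qed.

(** Modulo the augmentation ideal of the level below [t], the coordinates
    [t'(x_i)] with [t' < t] are constants, and only polynomials in the
    [t(x_i)] remain. *)
Lemma sigma_subalg_upto_split t a : sigma_subalg (upto t) a ->
  exists2 z, polys t setT z & ideal_span (augmentation t) (a - z).
Proof.
have [M0 MD MM] := ideal_span_ideal (augmentation t).
have M_sub := ideal_subspace (ideal_span_ideal (augmentation t)).
have poly_sub := polys_subspace t setT.
have poly1 : polys t setT 1 by rewrite -(monomial0 t); exact: polys_monomial.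
have polyM x y : polys t setT x -> polys t setT y -> polys t setT (x * y).
  move=> + Py; move: x; apply: (@polys_ind _ _ [set x | polys t setT (x * y)]).
    split=> [|c u v Bu Bv] /=; first by rewrite mul0r; exact: (subspace0 poly_sub).
    by rewrite mulrDl -scalerAl; exact: (poly_sub.2).
  move=> al _ /=; move: y Py; apply: (@polys_ind _ _ [set y | polys t setT (monomial t al * y)]).
    split=> [|c u v Bu Bv] /=; first by rewrite mulr0; exact: (subspace0 poly_sub).
    by rewrite mulrDr -scalerAr; exact: (poly_sub.2).
  by move=> be _; rewrite /= -monomial_add; exact: polys_monomial.
move: a; apply: (@sigma_subalg_ind _ [set a | exists2 z, polys t setT z &
  ideal_span (augmentation t) (a - z)]) => [|t' i].
  split=> [|c x y [u Pu xu] [v Pv yv]|x y [u Pu xu] [v Pv yv]].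
  - by exists 1; rewrite ?subrr.
  - exists (c *: u + v); first exact: (poly_sub.2).
    by rewrite opprD addrACA -scalerBr; exact: M_sub.2.
  - exists (u * v); first exact: polyM.
    rewrite -(subrK (x * v) (x * y)) -addrA -mulrBr -mulrBl.
    by apply: MD; [exact: MM|rewrite mulrC; exact: MM].
case=> [->|lt_t].
  by exists (mon t (X i)); rewrite ?subrr //= -monomial_gen; exact: polys_monomial.
exists (eps (mon t' (X i)))%:A; first exact: (subspaceZ poly_sub).
apply: ideal_span_gen; split; last by rewrite linearB linearZ /= rmorph1 mulr1 subrr.
have C_alg := sigma_subalg_subalgebra (below t).
apply: (subspaceB (subalgebra_subspace C_alg)); first exact: sigma_subalg_gen.
by apply: (subspaceZ (subalgebra_subspace C_alg)); case: C_alg.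
Qed.

End SigmaHopf.

(** * Finite generation *)

Section Finiteness.
Context {n : nat} {k : fieldType} {sk : sigma_ring n k} {A : comAlgType k}.
Variable H : sigma_hopf_algebra sk A.
Local Notation Delta := (comul H).
Local Notation eps := (counit H).
Local Notation S := (antipode H).

Lemma sigma_ideal_gen_ideal (F : set A) : is_sigma_ideal H (sigma_ideal_gen H F).
Proof.
split=> [|j x Jx B BF]; last by case: (BF) => -[_ +] _; apply; exact: Jx.
split=> [B [[[]]]//|x y Jx Jy B BF|a x Jx B BF].
  by case: (BF) => -[[_ + _] _ _]; apply; [exact: Jx|exact: Jy].
by case: (BF) => -[[_ _ +] _ _]; apply; exact: Jx.
Qed.

Lemma sigma_ideal_gen_ind (F B : set A) : is_sigma_ideal H B -> F `<=` B ->
  sigma_ideal_gen H F `<=` B.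
Proof. by move=> B_id FB x /(_ B); exact. Qed.

(** The intersection of [I] with a finite-dimensional subcoalgebra stable
    under [S] is a coideal stable under [S], so the sigma-ideal generated by
    it is a sigma-Hopf ideal. The remainders of the elements of [E] after
    projection along a basis modulo [I] span this intersection. *)
Lemma ex_fin_gen_hopf_subideal (I : set A) (gs : seq A) :
    is_sigma_hopf_ideal H I -> {in gs, forall g, I g} ->
  exists F : seq A, let I' := sigma_ideal_gen H [set` F] in
    [/\ is_sigma_hopf_ideal H I', I' `<=` I & {in gs, forall g, I' g}].
Proof.
move=> [I_sigma [I_id I_comul I_eps I_S]] Igs.
have [E [E_coalg E_S E_gs]] := ex_finite_coalgebra H gs.
have I_sub := ideal_subspace I_id.
have D_sub := lin_span_subspace E.
have [|q [w [l [Dw lI _ IE]]]] := @dual_system _ _ I (lin_span E) E I_sub D_sub.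
  by move=> y; exact: mem_lin_span.
pose F := [seq y - \sum_i l i y *: w i | y <- E].
exists F => I'; have I'_sigma : is_sigma_ideal H I' by exact: sigma_ideal_gen_ideal.
have [I'_id I'_st] := I'_sigma; have I'_sub := ideal_subspace I'_id.
have [I'0 I'D I'M] := I'_id.
have I'F x : x \in F -> I' x by move=> Fx B [_]; exact.
have FI x : x \in F -> I x by case/mapP=> y /IE Iy ->.
have I'I : I' `<=` I by apply: sigma_ideal_gen_ind.
have I_E_I' : I `&` lin_span E `<=` I'.
  move=> x [Ix Ex]; suff : I' (x - \sum_i l i x *: w i).
    by rewrite big1 ?subr0 // => i _; rewrite lI // scale0r.
  apply: (Ex [set x | I' (x - \sum_i l i x *: w i)]); split=> [|y yE]; last first.
    by apply: I'F; exact: (map_f (fun y => y - \sum_i l i y *: w i)).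
  split=> [|c y z I'y I'z] /=.
    by rewrite big1 ?subr0 // => i _; rewrite linear0 scale0r.
  suff -> : c *: y + z - \sum_i l i (c *: y + z) *: w i =
      c *: (y - \sum_i l i y *: w i) + (z - \sum_i l i z *: w i) by exact: I'_sub.2.
  rewrite scalerBr scaler_sumr addrACA -opprD -big_split; congr (_ - _).
  by apply: eq_bigr => i _; rewrite linearP scalerDl scalerA.
have F_E x : x \in F -> lin_span E x.
  case/mapP=> y yE ->; apply: (subspaceB D_sub); first exact: mem_lin_span.
  by apply: (subspace_sum D_sub) => i _; exact: (subspaceZ D_sub).
have E_comul x : lin_span E x -> pure_sums (lin_span E `*` lin_span E) (Delta x).
  move/(_ [set x | pure_sums (lin_span E `*` lin_span E) (Delta x)]); apply; split=> [|y yE].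
    split=> [|c y z Py Pz] /=; first by rewrite raddf0; exact: pure_sums0.
    rewrite linearP; apply: pure_sumsD => //.
    apply: (pure_sums_ind (f := fun x => c *: x)) Py => [u v|||u v [/= Pu Pv]].
    + exact: scalerDr.
    + exact: pure_sums0.
    + exact: pure_sumsD.
    + by rewrite -tensZl; apply: pure_sums_tens; split=> //; exact: (subspaceZ D_sub).
  by apply: sub_pure_sums (E_coalg y yE) => -[u v] [/= uE vE]; split; exact: mem_lin_span.
have E_antipode x : lin_span E x -> lin_span E (S x).
  move/(_ [set x | lin_span E (S x)]); apply; split=> [|y yE] /=; last by apply: mem_lin_span; exact: E_S.
  split=> [|c y z Sy Sz] /=; first by rewrite raddf0; exact: (subspace0 D_sub).
  by rewrite linearP; exact: D_sub.2.
exists; last first.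
- by move=> g g_gs; apply: I_E_I'; split; [exact: Igs|exact: E_gs].
- exact: I'I.
split=> //; split=> // [|x /I'I/I_eps//|].
- apply: (@sigma_ideal_gen_ind _ [set x | pure_sums (in_either I' I') (Delta x)]).
    have [T0 TD TM] := ideal_pure_sums I'_id I'_id.
    split=> [|j x Tx] /=.
      split=> [|x y Tx Ty|a x Tx] /=; first by rewrite raddf0.
        by rewrite raddfD; exact: TD.
      by rewrite rmorphM; exact: TM.
    rewrite (sigma_comul H) /=.
    apply: (pure_sums_ind (tens_sigmaD _ _ _)) Tx => [||r s [/= Ir|/= Is]].
    + exact: pure_sums0.
    + exact: pure_sumsD.
    + by rewrite tens_sigmaE; apply: pure_sums_tens; left; exact: I'_st.
    + by rewrite tens_sigmaE; apply: pure_sums_tens; right; exact: I'_st.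
  move=> x xF /=; have Ex := F_E x xF.
  have := pure_sums_restrict D_sub D_sub I_sub (E_comul x Ex) (I_comul x (FI x xF)).
  apply: sub_pure_sums => -[r s] [[/= Er Es] [/= Ir|/= Is]]; [left|right]; exact: I_E_I'.
- apply: (@sigma_ideal_gen_ind _ [set x | I' (S x)]).
    split=> [|j x I'x] /=; last by rewrite (sigma_antipode H); exact: I'_st.
    split=> [|x y Sx Sy|a x Sx] /=; first by rewrite raddf0.
      by rewrite raddfD; exact: I'D.
    by rewrite rmorphM; exact: I'M.
  move=> x xF /=; apply: I_E_I'; split; [apply: I_S; exact: FI|apply: E_antipode; exact: F_E].
Qed.

(** By Dickson's lemma every leading pair of [I] is obtained by addition from
    one of finitely many. Witnesses of the latter that lie in [K] make them
    leading for [K], and the leading pairs of the sigma-ideal [K] are stable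
    under addition. *)
Lemma ex_leading_generators (m : nat) (X : 'I_m -> A) (I : set A) : is_ideal I ->
  exists2 gs : seq A, {in gs, forall g, I g} &
    forall K, is_sigma_ideal H K -> {in gs, forall g, K g} ->
    forall t al, leading H X I t al -> leading H X K t al.
Proof.
move=> I_id.
have [s s_lead lead_s] := dickson_pairs [set p | leading H X I p.1 p.2].
have [gs Igs gsP] : exists2 gs : seq A, {in gs, forall g, I g} &
    {in s, forall p, forall K, is_ideal K -> {in gs, forall g, K g} ->
      leading H X K p.1 p.2}.
  elim: s s_lead {lead_s} => [|p s IH] s_lead; first by exists [::].
  have [|gs Igs gsP] := IH; first by move=> q qs; apply: s_lead; rewrite inE qs orbT.
  have [g Ig gP] := leading_witness I_id (s_lead p (mem_head _ _)).
  exists (g :: gs) => [h|q]; first by rewrite inE => /orP[/eqP->|/Igs].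
  rewrite inE => /orP[/eqP->|qs] K K_id K_gs.
    by apply: gP => //; apply: K_gs; exact: mem_head.
  by apply: gsP => // h hgs; apply: K_gs; rewrite inE hgs orbT.
exists gs => // K K_sigma K_gs t al lead.
have [q qs [r [c [-> ->]]]] := lead_s (t, al) lead.
by apply: leading_shift => //; apply: gsP => //; case: K_sigma.
Qed.

End Finiteness.

Theorem theorem1 (n : nat) (n_ge1 : (1 <= n)%N) (k : fieldType)
    (sk : sigma_ring n k) (A : comAlgType k) (H : sigma_hopf_algebra sk A)
    (A_fin : fin_sigma_gen_algebra H) (I : set A)
    (I_hopf : is_sigma_hopf_ideal H I) :
  fin_sigma_gen_ideal H I.
Proof.
have [F0 /finite_seqP[gens ->] genA] := A_fin.
have [E [E_coalg _ E_gens]] := ex_finite_coalgebra H gens.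
pose X i := tnth (in_tuple E) i.
have X_coalg i : pure_sums ([set x | exists j, x = X j] `*` [set x | exists j, x = X j])
    (comul H (X i)).
  apply: sub_pure_sums (E_coalg _ (mem_tnth i (in_tuple E))) => -[u v] [/= uE vE].
  by split=> /=; [have /seq_tnthP[j ->] := uE|have /seq_tnthP[j ->] := vE]; exists j.
have algT a : sigma_subalg H X setT a.
  have T_alg := sigma_subalg_subalgebra H X setT; have T_sub := subalgebra_subspace T_alg.
  have : [set: A] a by []; rewrite -genA; apply; split=> // _ [e [f f_gens ->]].
  apply: (E_gens f f_gens [set f | sigma_subalg H X setT (sigma_mon H e f)]); split=> [|y yE].
    split=> [|c x y Tx Ty] /=; first by rewrite rmorph0; exact: (subspace0 T_sub).
    by rewrite rmorphD /= sigma_monZ; exact: T_sub.2.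
  have /seq_tnthP[i ->] := yE; rewrite /= (@sigma_mon_eq _ _ _ _ [ffun j => e j]).
    exact: sigma_subalg_gen.
  by move=> j; rewrite ffunE.
have [I_sigma I_H] := I_hopf; have [I_id I_comul I_eps I_S] := I_H.
have [gs Igs gsP] := ex_leading_generators H X I_id.
have [F [[I'_sigma I'_H] I'I I'gs]] := ex_fin_gen_hopf_subideal I_hopf Igs.
set I' := sigma_ideal_gen H [set` F] in I'_sigma I'_H I'I I'gs.
have I'_id : is_ideal I' by case: I'_sigma.
exists [set` F]; first exact: finite_seq.
rewrite eqEsubset; split; last exact: I'I.
have collect P : (forall t, P t -> I `&` sigma_subalg H X (upto t) `<=` I') -> I `&` sigma_subalg H X P `<=` I'.
  move=> IH x [Ix /sigma_subalg_upto[[c xc]|[t Pt tx]]]; last by apply: (IH t).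
  move: (I_eps x Ix); rewrite xc linearZ /= rmorph1 mulr1 => ->.
  by rewrite scale0r; case: I'_id.
suff step t : I `&` sigma_subalg H X (upto t) `<=` I'.
  by move=> x Ix; apply: (collect setT) => // t _; exact: step.
apply: contrapT => nstep.
have [|t0 nt0 min_t0] := @lexlt_min _ [set t | ~ (I `&` sigma_subalg H X (upto t) `<=` I')].
  by exists t.
(* At a minimal level t0 where the two ideals differ, they agree below t0 and
   have the same kernel. *)
apply: nt0; apply: (hopf_ideals_agree I_H I'_H I'I (sigma_subalg_subalgebra H X (below t0))).
- exact: sigma_subalg_comul.
- by apply: subalgebra_subspace; exact: sigma_subalg_subalgebra.
- exact: sigma_subalg_comul.
- by apply: collect => t1 lt_t1; apply: contrapT => /min_t0/negP; apply.
- move=> x [Ix /sigma_subalg_upto_split[z Pz xz]].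
  have M'_id := ideal_span_ideal (I' `|` augmentation H X t0).
  have M_id := ideal_span_ideal (I `|` augmentation H X t0).
  have sub K : ideal_span (augmentation H X t0) `<=` modulo H X K t0.
    apply: ideal_span_ind => [|y Cy]; first exact: ideal_span_ideal.
    by apply: ideal_span_gen; right.
  have Mz : modulo H X I t0 z.
    rewrite -(subKr x z); apply: (idealB M_id); last exact: sub.
    by apply: ideal_span_gen; left.
  rewrite -(subrK z x); have [_ MD _] := M'_id; apply: MD; first exact: sub.
  apply: (modulo_of_leading I_id I'_id I'I) => //.
  exact: gsP.
Qed.
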